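(* For the moduli space $\mathcal{M}(0,\frac{2\pi}{3},\frac{4\pi}{3})=\{\rho(\alpha,\beta):(\alpha,\beta)\in[0,\frac\pi2]^2\}$: (1) There is a neighborhood $\mathcal{N}$ of the point $(\alpha,\beta)=(\frac{\pi}{2},0)$ in the square $[0,\frac{\pi}{2}]^2$ such that for any $(\alpha,\beta)\in\mathcal{N}$ the representation $\rho(\alpha,\beta)$ is discrete and faithful. (2) There is a neighborhood $\mathcal{N}$ of the point $(\alpha,\beta)=(\frac{\pi}{2},\frac{\pi}{2})$ in the square $[0,\frac{\pi}{2}]^2$ such that for any $(\alpha,\beta)\in\mathcal{N}$ the representation $\rho(\alpha,\beta)$ is discrete and faithful.
   Context: $\mathbf{PSL}(2,\mathbb{Z})=\langle a_0,a_1,a_2\mid a_2^2=a_1^3=1,\ a_2a_1=a_0\rangle$. $\mathbb{C}^{3,1}$ is $\mathbb{C}^4$ with the Hermitian form $\langle z,w\rangle=z_1\overline{w_4}+z_2\overline{w_2}+z_3\overline{w_3}+z_4\overline{w_1}$; $\mathbf{H}^3_{\mathbb C}\subset\mathbb{CP}^3$ is the set of negative lines and $\mathbf{PU}(3,1)$ its group of holomorphic isometries. For $(\alpha,\beta)\in[0,\frac{\pi}{2}]^2$ put $$M_0=\begin{pmatrix}0&0&0&1\\0&1&0&0\\0&0&1&0\\1&0&0&0\end{pmatrix},\quad M_1=\mathrm{diag}(1,-1,1,1),\quad U=\begin{pmatrix}1&0&0&0\\0&\cos\beta&-\sin\beta&0\\0&\sin\beta&\cos\beta&0\\0&0&0&1\end{pmatrix},$$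 $$M_2(\alpha,0)=\begin{pmatrix}1&u&0&-e^{-i\alpha}\\0&e^{-i\alpha}&0&u\\0&0&-e^{-i\alpha/3}&0\\0&0&0&1\end{pmatrix},\quad u=i e^{-i\alpha/2}\sqrt{2\cos\alpha},\quad M_2=UM_2(\alpha,0)U^{-1}.$$ Let $\iota_j$ be the anti-holomorphic isometry of $\mathbf{H}^3_{\mathbb C}$ induced by $z\mapsto M_j\bar z$. The representation $\rho(\alpha,\beta):\mathbf{PSL}(2,\mathbb{Z})\to\mathbf{PU}(3,1)$ is $a_2\mapsto A_2=\iota_1\iota_0$, $a_1\mapsto A_1=\iota_0\iota_2$, $a_0\mapsto A_0=\iota_1\iota_2$ (the classes of $M_1\overline{M_0}$, $M_0\overline{M_2}$, $M_1\overline{M_2}$). *)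

(* Defs.v *)
From HB Require Import structures.
From mathcomp Require Import all_boot all_order all_algebra.
From mathcomp Require Import all_classical all_reals all_analysis.
From mathcomp Require Import complex ring.
Set Implicit Arguments.
Unset Strict Implicit.
Unset Printing Implicit Defensive.
Import Order.TTheory GRing.Theory Num.Theory.
Import numFieldNormedType.Exports.
Local Open Scope classical_set_scope.
Local Open Scope ring_scope.
Local Open Scope complex_scope.
Local Open Scope quotient_scope.

(* The letter (i, false) stands for the generator i, (i, true) for its
   inverse. *)
Definition word (I : Type) : Type := seq (I * bool).

Definition inv_letter (I : Type) (x : I * bool) : I * bool := (x.1, ~~ x.2).

Inductive pres_eq (I : eqType) (rels : seq (word I)) :
    word I -> word I -> Prop :=
| pres_refl u : pres_eq rels u u
| pres_sym u v : pres_eq rels u v -> pres_eq rels v u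
| pres_trans v u w : pres_eq rels u v -> pres_eq rels v w -> pres_eq rels u w
| pres_cancel u x v : pres_eq rels (u ++ [:: x; inv_letter x] ++ v) (u ++ v)
| pres_rel u r v : r \in rels -> pres_eq rels (u ++ r ++ v) (u ++ v).

Section Presentation.
Context (I : choiceType) (rels : seq (word I)).
Implicit Types u v w : word I.

Lemma pres_eq_cat u u' v v' :
  pres_eq rels u u' -> pres_eq rels v v' -> pres_eq rels (u ++ v) (u' ++ v').
Proof.
have catl s t t' : pres_eq rels t t' -> pres_eq rels (s ++ t) (s ++ t').
  elim=> [t1|t1 t2 _ IH|t1 t2 t3 _ IH1 _ IH2|t1 x t2|t1 r t2 rr].
  - exact: pres_refl.
  - exact: pres_sym.
  - exact: pres_trans IH1 IH2.
  - by rewrite !(catA s); exact: pres_cancel.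
  - by rewrite !(catA s); exact: (pres_rel _ _ rr).
have catr s t t' : pres_eq rels t t' -> pres_eq rels (t ++ s) (t' ++ s).
  elim=> [t1|t1 t2 _ IH|t1 t2 t3 _ IH1 _ IH2|t1 x t2|t1 r t2 rr].
  - exact: pres_refl.
  - exact: pres_sym.
  - exact: pres_trans IH1 IH2.
  - by rewrite -!catA; exact: pres_cancel.
  - by rewrite -!catA; exact: (pres_rel _ _ rr).
by move=> uu' vv'; apply: (@pres_trans _ _ (u' ++ v)); [exact: catr|exact: catl].
Qed.

Definition inv_word w : word I := rev (map (@inv_letter I) w).

Lemma inv_letterK : involutive (@inv_letter I).
Proof. by case=> i b; rewrite /inv_letter /= negbK. Qed.

Lemma inv_wordK : involutive inv_word.
Proof.
by move=> w; rewrite /inv_word map_rev revK -map_comp map_id_in // => x _;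
  exact: inv_letterK.
Qed.

Lemma pres_eq_mulV w : pres_eq rels (w ++ inv_word w) [::].
Proof.
elim: w => [|x w IH]; first exact: pres_refl.
rewrite /inv_word /= rev_cons -cats1 catA.
apply: pres_trans (pres_cancel rels [::] x [::]).
have := pres_eq_cat (pres_eq_cat (pres_refl rels [:: x]) IH)
  (pres_refl rels [:: inv_letter x]).
by rewrite /= -!catA.
Qed.

Lemma pres_eq_Vmul w : pres_eq rels (inv_word w ++ w) [::].
Proof. by rewrite -{2}(inv_wordK w); exact: pres_eq_mulV. Qed.

Definition pres_eqb u v : bool := `[< pres_eq rels u v >].

Lemma pres_eqb_equiv : equiv_class_of pres_eqb.
Proof.
split=> [u|u v|v u w].
- by apply/asboolP; exact: pres_refl.
- by apply/asboolP/asboolP; exact: pres_sym.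
- by move=> /asboolP uv /asboolP vw; apply/asboolP; exact: pres_trans uv vw.
Qed.

Canonical pres_equiv := EquivRelPack pres_eqb_equiv.

Definition presented := {eq_quot pres_equiv}.

HB.instance Definition _ := Choice.on presented.
HB.instance Definition _ := EqQuotient.on presented.

Lemma pres_piP u v : \pi_presented u = \pi_presented v <-> pres_eq rels u v.
Proof. by split=> [/eqmodP/asboolP|uv]; last by apply/eqmodP/asboolP. Qed.

Lemma pres_repr u : pres_eq rels (repr (\pi_presented u)) u.
Proof. by apply/pres_piP; rewrite reprK. Qed.

Definition pres_one : presented := \pi_presented [::].
Definition pres_mul (x y : presented) : presented := \pi_presented (repr x ++ repr y).
Definition pres_inv (x : presented) : presented := \pi_presented (inv_word (repr x)).

Lemma presW (x : presented) : exists u, x = \pi_presented u.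
Proof. by exists (repr x); rewrite reprK. Qed.

Lemma pres_mulE u v :
  pres_mul (\pi_presented u) (\pi_presented v) = \pi_presented (u ++ v).
Proof. by apply/pres_piP; apply: pres_eq_cat; exact: pres_repr. Qed.

Lemma pres_mulA : associative pres_mul.
Proof.
by move=> x y z; have [u ->] := presW x; have [v ->] := presW y;
  have [w ->] := presW z; rewrite !pres_mulE catA.
Qed.

Lemma pres_mul1 : left_id pres_one pres_mul.
Proof. by move=> x; have [u ->] := presW x; rewrite pres_mulE. Qed.

Lemma pres_mulr1 : right_id pres_one pres_mul.
Proof. by move=> x; have [u ->] := presW x; rewrite pres_mulE cats0. Qed.

Lemma pres_mulV : left_inverse pres_one pres_inv pres_mul.
Proof.
by move=> x; rewrite -{2}[x]reprK pres_mulE; apply/pres_piP; exact: pres_eq_Vmul.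
Qed.

Lemma pres_mulrV : right_inverse pres_one pres_inv pres_mul.
Proof.
by move=> x; rewrite -{1}[x]reprK pres_mulE; apply/pres_piP; exact: pres_eq_mulV.
Qed.

HB.instance Definition _ := isGroup.Build presented
  pres_mulA pres_mul1 pres_mulr1 pres_mulV pres_mulrV.

Lemma pres_mulgE u v :
  (\pi_presented u * \pi_presented v)%g = \pi_presented (u ++ v).
Proof. exact: pres_mulE. Qed.

Definition pres_gen (i : I) : presented := \pi_presented [:: (i, false)].

End Presentation.

Definition word_eval (I : Type) (G : groupType) (f : I -> G) (w : word I) : G :=
  foldr (fun x g => ((if x.2 then (f x.1)^-1 else f x.1) * g)%g) 1%g w.

Section Lift.
Context (I : choiceType) (rels : seq (word I)) (G : groupType) (f : I -> G).
Hypothesis f_rels : {in rels, forall r, word_eval f r = 1%g}.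

Lemma word_eval_cat u v :
  word_eval f (u ++ v) = (word_eval f u * word_eval f v)%g.
Proof. by elim: u => /= [|x u ->]; rewrite ?mul1g ?mulgA. Qed.

Lemma word_eval_pres u v : pres_eq rels u v -> word_eval f u = word_eval f v.
Proof.
elim=> //= [? ? ? _ -> _ -> //|u1 x v1|u1 r v1 /f_rels rr].
  rewrite !word_eval_cat /=; congr (_ * _)%g.
  by case: x => i [] /=; rewrite !mulgA ?mulVg ?mulgV mul1g.
by rewrite !word_eval_cat rr mul1g.
Qed.

Definition pres_lift (x : presented rels) : G := word_eval f (repr x).

Lemma pres_lift_pi u : pres_lift (\pi_(presented rels) u) = word_eval f u.
Proof. by apply: word_eval_pres; exact: pres_repr. Qed.

Lemma pres_lift_gen i : pres_lift (pres_gen rels i) = f i.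
Proof. by rewrite pres_lift_pi /= mulg1. Qed.

Lemma pres_liftM : {morph pres_lift : x y / (x * y)%g}.
Proof.
by move=> x y; have [u ->] := presW x; have [v ->] := presW y; rewrite pres_mulgE !pres_lift_pi word_eval_cat.
Qed.

End Lift.

(* R[i] with the topology of its norm. *)
HB.instance Definition _ (R : realType) :=
  PseudoPointedMetric.copy R[i] (R[i])^o.

Definition mx4 (T : pzRingType) (s : seq (seq T)) : 'M[T]_4 :=
  \matrix_(i, j) nth 0 (nth [::] s i) j.

Lemma big_ord4 (V : nmodType) (F : 'I_4 -> V) :
  \sum_i F i = F 0 + F 1 + F 2 + F 3.
Proof.
rewrite !big_ord_recl big_ord0 addr0 !addrA.
by congr (_ + F _ + F _ + F _); exact/val_inj.
Qed.

Section Mx4.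
Context (T : comPzRingType).
Implicit Types s t : seq (seq T).

Lemma mul_mx4 s t : mx4 s *m mx4 t = mx4 (mkseq (fun i => mkseq (fun j =>
    nth 0 (nth [::] s i) 0 * nth 0 (nth [::] t 0) j +
    nth 0 (nth [::] s i) 1 * nth 0 (nth [::] t 1) j +
    nth 0 (nth [::] s i) 2 * nth 0 (nth [::] t 2) j +
    nth 0 (nth [::] s i) 3 * nth 0 (nth [::] t 3) j) 4) 4).
Proof. by apply/matrixP => i j; rewrite !mxE big_ord4 !mxE !nth_mkseq. Qed.

Lemma tr_mx4 s :
  (mx4 s)^T = mx4 (mkseq (fun i => mkseq (fun j => nth 0 (nth [::] s j) i) 4) 4).
Proof. by apply/matrixP => i j; rewrite !mxE !nth_mkseq. Qed.

Lemma scalar_mx4 (x : T) :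
  x%:M = mx4 [:: [:: x; 0; 0; 0]; [:: 0; x; 0; 0];
                 [:: 0; 0; x; 0]; [:: 0; 0; 0; x]].
Proof.
by apply/matrixP; case=> [[|[|[|[|//]]]] ?]; case=> [[|[|[|[|//]]]] ?];
  rewrite !mxE.
Qed.

End Mx4.

Lemma conjmx_cube (T : comUnitRingType) n (U B : 'M[T]_n) : U \in unitmx ->
  let A := U *m B *m invmx U in
  A *m A *m A = U *m (B *m B *m B) *m invmx U.
Proof. by move=> Uu /=; rewrite !mulmxA !mulmxKV. Qed.

Ltac simp4 := rewrite ?(mulr0, mul0r, mulr1, mul1r, addr0, add0r, mulrN, mulNr,
  opprK, oppr0).

Section PU31.
Context (R : realType).
Local Notation C := R[i].
Implicit Types A B : 'M[C]_4.

Definition conj_mx m n (A : 'M[C]_(m, n)) : 'M[C]_(m, n) := map_mx conjc A.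

(* The coordinates z_1, ..., z_4 are z 0 0, ..., z 3 0. *)
Definition herm (z w : 'cV[C]_4) : C :=
  z 0 0 * (w 3 0)^*%C + z 1 0 * (w 1 0)^*%C + z 2 0 * (w 2 0)^*%C +
  z 3 0 * (w 0 0)^*%C.

Definition U31_set : set 'M[C]_4 :=
  [set A | forall z w, herm (A *m z) (A *m w) = herm z w].

Definition M0 : 'M[C]_4 :=
  mx4 [:: [:: 0; 0; 0; 1];
          [:: 0; 1; 0; 0];
          [:: 0; 0; 1; 0];
          [:: 1; 0; 0; 0]].

Lemma hermE z w : herm z w = (z^T *m M0 *m conj_mx w) 0 0.
Proof.
rewrite mxE big_ord4 !mxE !big_ord4 !mxE /= /herm.
rewrite !(mulr0, mulr1, addr0, add0r).
ring.
Qed.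

Lemma M0K : M0 *m M0 = 1%:M.
Proof.
apply/matrixP => i j; rewrite mxE big_ord4 !mxE /=.
case: i => [[|[|[|[|//]]]] ?]; case: j => [[|[|[|[|//]]]] ?] /=;
  by rewrite !(mulr0, mulr1, addr0, add0r).
Qed.

Lemma U31P A : U31_set A <-> A^T *m M0 *m conj_mx A = M0.
Proof.
split=> [UA|UA z w]; last first.
  rewrite !hermE trmx_mul -!mulmxA.
  have -> : conj_mx (A *m w) = conj_mx A *m conj_mx w by rewrite /conj_mx map_mxM.
  by rewrite !mulmxA -(mulmxA _ A^T) -(mulmxA _ (_ *m _)) UA.
apply/matrixP => i j.
have := UA (delta_mx i 0) (delta_mx j 0).
have dE (B : 'M[C]_4) :
    ((delta_mx i 0 : 'cV_4)^T *m B *m (conj_mx (delta_mx j 0) : 'cV_4)) 0 0 = B i j.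
  rewrite /conj_mx map_delta_mx trmx_delta -rowE -colE.
  by rewrite !mxE.
rewrite !hermE dE => <-.
rewrite trmx_mul -!mulmxA.
have -> : conj_mx (A *m delta_mx j 0) = conj_mx A *m conj_mx (delta_mx j 0 : 'cV_4)
  by rewrite /conj_mx map_mxM.
by rewrite -dE !mulmxA.
Qed.

Lemma U31_1 : 1%:M \in U31_set.
Proof. by apply/mem_set => z w; rewrite !mul1mx. Qed.

Lemma U31_mul A B : A \in U31_set -> B \in U31_set -> A *m B \in U31_set.
Proof.
move=> /set_mem UA /set_mem UB; apply/mem_set => z w.
by rewrite -!mulmxA UA UB.
Qed.

Lemma U31_unit A : A \in U31_set -> A \in unitmx.
Proof.
move=> /set_mem/U31P UA; rewrite -unitmx_tr.
have /mulmx1_unit[] // : A^T *m (M0 *m conj_mx A *m M0) = 1%:M.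
by rewrite !mulmxA UA M0K.
Qed.

Lemma U31_inv A : A \in U31_set -> invmx A \in U31_set.
Proof.
move=> UA; have Au := U31_unit UA; apply/mem_set => z w.
by move/set_mem: UA => <-; rewrite !mulmxA mulmxV // !mul1mx.
Qed.

Definition U31 : Type := set_type U31_set.

HB.instance Definition _ := Topological.copy U31 (set_type U31_set).
HB.instance Definition _ := SubType.copy U31 (set_type U31_set).

Definition mkU31 A (UA : A \in U31_set) : U31 := exist _ A UA.

Definition U31_one : U31 := mkU31 U31_1.
Definition U31_prod (a b : U31) : U31 := mkU31 (U31_mul (valP a) (valP b)).
Definition U31_invg (a : U31) : U31 := mkU31 (U31_inv (valP a)).

Lemma U31_mulA : associative U31_prod.
Proof. by move=> a b c; apply/val_inj; rewrite /= mulmxA. Qed.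

Lemma U31_mul1 : left_id U31_one U31_prod.
Proof. by move=> a; apply/val_inj; rewrite /= mul1mx. Qed.

Lemma U31_mulr1 : right_id U31_one U31_prod.
Proof. by move=> a; apply/val_inj; rewrite /= mulmx1. Qed.

Lemma U31_mulV : left_inverse U31_one U31_invg U31_prod.
Proof. by move=> a; apply/val_inj; rewrite /= mulVmx ?U31_unit ?(valP a). Qed.

Lemma U31_mulrV : right_inverse U31_one U31_invg U31_prod.
Proof. by move=> a; apply/val_inj; rewrite /= mulmxV ?U31_unit ?(valP a). Qed.

HB.instance Definition _ := isGroup.Build U31
  U31_mulA U31_mul1 U31_mulr1 U31_mulV U31_mulrV.

(* PU(3,1) is U(3,1) modulo its scalar matrices, with the quotient topology. *)
Definition proj_eq (a b : U31) : bool :=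
  `[< exists2 c : C, c != 0 & \val a = c *: \val b >].

Lemma proj_eq_equiv : equiv_class_of proj_eq.
Proof.
have sym a b : proj_eq a b -> proj_eq b a.
  move=> /asboolP[c c0 e]; apply/asboolP; exists c^-1; first by rewrite invr_eq0.
  by rewrite e scalerA mulVf // scale1r.
split=> [a|a b|b a c].
- by apply/asboolP; exists 1; rewrite ?oner_eq0 ?scale1r.
- by apply/idP/idP; exact: sym.
- move=> /asboolP[s s0 es] /asboolP[t t0 et]; apply/asboolP; exists (s * t).
    by rewrite mulf_neq0.
  by rewrite es et scalerA.
Qed.

Canonical proj_equiv := EquivRelPack proj_eq_equiv.

Definition PU31 : Type := quotient_topology {eq_quot proj_equiv}.

HB.instance Definition _ :=
  Topological.copy PU31 (quotient_topology {eq_quot proj_equiv}).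
HB.instance Definition _ :=
  Quotient.copy PU31 (quotient_topology {eq_quot proj_equiv}).

Definition PU_class (a : U31) : PU31 := \pi_PU31 a.

Lemma PU_classP a b : PU_class a = PU_class b <->
  exists2 c : C, c != 0 & \val a = c *: \val b.
Proof.
have E : \pi_({eq_quot proj_equiv}) a = \pi_({eq_quot proj_equiv}) b
    <-> proj_eq a b by split=> [/eqmodP|/eqmodP].
by split=> [/E/asboolP|ab] //; apply/E/asboolP.
Qed.

Lemma PU_classW (x : PU31) : exists a, x = PU_class a.
Proof. by exists (repr x); rewrite /PU_class reprK. Qed.

Definition PU_one : PU31 := PU_class 1%g.
Definition PU_mul (x y : PU31) : PU31 := PU_class (repr x * repr y)%g.
Definition PU_inv (x : PU31) : PU31 := PU_class (repr x)^-1%g.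

Lemma PU_repr a : PU_class (repr (PU_class a)) = PU_class a.
Proof. by rewrite /PU_class reprK. Qed.

Lemma PU_mulE a b : PU_mul (PU_class a) (PU_class b) = PU_class (a * b)%g.
Proof.
have /PU_classP[s s0 es] := PU_repr a; have /PU_classP[t t0 et] := PU_repr b.
apply/PU_classP; exists (s * t); first by rewrite mulf_neq0.
by rewrite /= es et -scalemxAl -scalemxAr scalerA.
Qed.

Lemma PU_mulA : associative PU_mul.
Proof.
by move=> x y z; have [a ->] := PU_classW x; have [b ->] := PU_classW y;
  have [c ->] := PU_classW z; rewrite !PU_mulE mulgA.
Qed.

Lemma PU_mul1 : left_id PU_one PU_mul.
Proof. by move=> x; have [a ->] := PU_classW x; rewrite PU_mulE mul1g. Qed.

Lemma PU_mulr1 : right_id PU_one PU_mul.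
Proof. by move=> x; have [a ->] := PU_classW x; rewrite PU_mulE mulg1. Qed.

Lemma PU_mulV : left_inverse PU_one PU_inv PU_mul.
Proof.
by move=> x; rewrite -{2}[x]reprK PU_mulE mulVg.
Qed.

Lemma PU_mulrV : right_inverse PU_one PU_inv PU_mul.
Proof.
by move=> x; rewrite -{1}[x]reprK PU_mulE mulgV.
Qed.

HB.instance Definition _ := isGroup.Build PU31
  PU_mulA PU_mul1 PU_mulr1 PU_mulV PU_mulrV.

Lemma PU_classM a b : PU_class (a * b)%g = (PU_class a * PU_class b)%g.
Proof. by rewrite -PU_mulE. Qed.

Lemma PU_class1P a :
  PU_class a = 1%g <-> exists2 c : C, c != 0 & \val a = c%:M.
Proof.
by split=> [/PU_classP[c c0 e]|[c c0 e]]; first (exists c => //);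
  [|apply/PU_classP; exists c => //]; rewrite e /= scalemx1.
Qed.

End PU31.

(* The generators a_0, a_1, a_2 are indexed by 0, 1, 2 : 'I_3; the relators
   are a_2 a_2, a_1 a_1 a_1 and a_2 a_1 a_0^-1. *)
Definition PSL2Z_rels : seq (word 'I_3) :=
  [:: [:: (2, false); (2, false)];
      [:: (1, false); (1, false); (1, false)];
      [:: (2, false); (1, false); (0, true)]].

Definition PSL2Z := presented PSL2Z_rels.

HB.instance Definition _ := Group.copy PSL2Z (presented PSL2Z_rels).

Section Representation.
Context (R : realType).
Local Notation C := R[i].

Definition square : set (R * R) := `[0, pi / 2] `*` `[0, pi / 2].

(* exp (i t) *)
Definition cis (t : R) : C := cos t +i* sin t.

Definition M1 : 'M[C]_4 :=
  mx4 [:: [:: 1;  0; 0; 0];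
          [:: 0; -1; 0; 0];
          [:: 0;  0; 1; 0];
          [:: 0;  0; 0; 1]].

Definition Umx (b : R) : 'M[C]_4 :=
  mx4 [:: [:: 1;           0;             0; 0];
          [:: 0;  (cos b)%:C;  - (sin b)%:C; 0];
          [:: 0;  (sin b)%:C;    (cos b)%:C; 0];
          [:: 0;           0;             0; 1]].

Definition uC (a : R) : C :=
  (0 +i* 1) * cis (- (a / 2)) * (Num.sqrt (2 * cos a))%:C.

Definition M2_0 (a : R) : 'M[C]_4 :=
  mx4 [:: [:: 1;       uC a;                 0; - cis (- a)];
          [:: 0; cis (- a);                 0;        uC a];
          [:: 0;          0; - cis (- (a / 3));           0];
          [:: 0;          0;                 0;           1]].

(* p is the pair (alpha, beta). *)
Definition M2 (p : R * R) : 'M[C]_4 :=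
  Umx p.2 *m M2_0 p.1 *m invmx (Umx p.2).

(* The composite of z |-> M (conj z) after z |-> N (conj z) is
   z |-> M (conj N) z. *)
Definition A0 p : 'M[C]_4 := M1 *m conj_mx (M2 p).
Definition A1 p : 'M[C]_4 := M0 R *m conj_mx (M2 p).
Definition A2 : 'M[C]_4 := M1 *m conj_mx (M0 R).

Lemma cisD s t : cis (s + t) = cis s * cis t.
Proof. by rewrite /cis cosD sinD; simpc; rewrite [_ + _ * cos t]addrC. Qed.

Lemma cis0 : cis 0 = 1.
Proof. by rewrite /cis cos0 sin0. Qed.

Lemma conj_cis t : conjc (cis t) = cis (- t).
Proof. by rewrite /cis cosN sinN. Qed.

Lemma cisDN t : cis t + cis (- t) = (2 * cos t)%:C.
Proof.
by apply/eqP; rewrite eq_complex /= cosN sinN subrr mulr_natl mulr2n !eqxx.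
Qed.

Lemma conj_real (x : R) : conjc x%:C = x%:C.
Proof. by rewrite /conjc /= oppr0. Qed.

Lemma conjM (x y : C) : conjc (x * y) = conjc x * conjc y.
Proof. exact: rmorphM. Qed.

Lemma conjN (x : C) : conjc (- x) = - conjc x.
Proof. exact: rmorphN. Qed.

Local Arguments conjc : simpl never.

Lemma mx4_conj (s : seq (seq C)) :
  conj_mx (mx4 s) = mx4 (map (map conjc) s).
Proof.
apply/matrixP => i j; rewrite !mxE.
have H (t : seq C) : conjc (nth 0 t j) = nth 0 (map conjc t) j.
  have [jt|tj] := ltnP j (size t); first by rewrite (nth_map 0).
  by rewrite !nth_default ?size_map // conjc0.
rewrite H; congr nth.
have [it|ti] := ltnP i (size s); first by rewrite (nth_map [::]).
by rewrite !nth_default ?size_map.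
Qed.

Lemma conj_M0 : conj_mx (M0 R) = M0 R.
Proof. by rewrite mx4_conj /= conjc0 conjc1. Qed.

Lemma M0_U31 : M0 R \in @U31_set R.
Proof.
apply/mem_set/U31P; rewrite conj_M0 -mulmxA M0K mulmx1.
by rewrite tr_mx4 /mkseq /=.
Qed.

Lemma conj_M1 : conj_mx M1 = M1.
Proof. by rewrite mx4_conj /= conjc0 conjN conjc1. Qed.

Lemma M1K : M1 *m M1 = 1%:M.
Proof. by rewrite scalar_mx4 mul_mx4 /mkseq /=; simp4. Qed.

Lemma M1_M0 : M1 *m M0 R = M0 R *m M1.
Proof. by rewrite !mul_mx4 /mkseq /=; simp4. Qed.

Lemma M1_U31 : M1 \in @U31_set R.
Proof.
apply/mem_set/U31P; rewrite conj_M1.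
have -> : M1^T = M1 by rewrite tr_mx4 /mkseq /=.
by rewrite M1_M0 -mulmxA M1K mulmx1.
Qed.

Lemma conj_Umx b : conj_mx (Umx b) = Umx b.
Proof. by rewrite mx4_conj /= conjc0 conjc1 conjN !conj_real. Qed.

Lemma real_sqD b : (cos b)%:C * (cos b)%:C + (sin b)%:C * (sin b)%:C = 1 :> C.
Proof. by rewrite -!rmorphM -rmorphD -!expr2 cos2Dsin2. Qed.

Lemma Umx_tr b : (Umx b)^T *m Umx b = 1%:M.
Proof.
have E := real_sqD b.
rewrite tr_mx4 scalar_mx4 mul_mx4 /mkseq /=; simp4; rewrite E.
rewrite [(sin b)%:C * (sin b)%:C + _]addrC E [(sin b)%:C * (cos b)%:C]mulrC.
by rewrite addNr.
Qed.

Lemma Umx_M0 b : Umx b *m M0 R = M0 R *m Umx b.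
Proof. by rewrite !mul_mx4 /mkseq /=; simp4. Qed.

Lemma Umx_unit b : Umx b \in unitmx.
Proof. by have [] := mulmx1_unit (Umx_tr b). Qed.

Lemma Umx_U31 b : Umx b \in @U31_set R.
Proof.
apply/mem_set/U31P; rewrite conj_Umx -mulmxA -Umx_M0 mulmxA Umx_tr.
by rewrite mul1mx.
Qed.

Lemma uC_conj a : conjc (uC a) = - (uC a * cis a).
Proof.
rewrite /uC !conjM conj_cis opprK conj_real /=.
have -> : conjc (0 +i* 1 : C) = - (0 +i* 1) by rewrite /conjc; simpc.
have -> : cis (a / 2) = cis (- (a / 2)) * cis a.
  by rewrite -cisD; congr cis; field.
ring.
Qed.

Lemma uC_norm a : 0 <= cos a -> uC a * conjc (uC a) = cis a + cis (- a).
Proof.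
move=> a0; rewrite /uC !conjM conj_cis opprK conj_real /= cisDN.
have -> : conjc (0 +i* 1 : C) = - (0 +i* 1) by rewrite /conjc; simpc.
have I2 : (0 +i* 1 : C) * - (0 +i* 1) = 1 by simpc.
have K : cis (- (a / 2)) * cis (a / 2) = 1 by rewrite -cisD addNr cis0.
have S : (Num.sqrt (2 * cos a))%:C * (Num.sqrt (2 * cos a))%:C = (2 * cos a)%:C.
  by rewrite -rmorphM -expr2 sqr_sqrtr // mulr_ge0.
transitivity (((0 +i* 1 : C) * - (0 +i* 1)) * (cis (- (a / 2)) * cis (a / 2)) *
  ((Num.sqrt (2 * cos a))%:C * (Num.sqrt (2 * cos a))%:C)); first by ring.
by rewrite I2 K S !mul1r.
Qed.

Lemma cisNK a : cis (- a) * cis a = 1.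
Proof. by rewrite -cisD addNr cis0. Qed.

Lemma M2_0_U31 a : 0 <= cos a -> M2_0 a \in @U31_set R.
Proof.
move=> a0; have N := uC_norm a0; have K := cisNK a; have K3 := cisNK (a / 3).
have E := uC_conj a.
apply/mem_set/U31P; rewrite mx4_conj /= !conjc0 !conjc1 !conjN !conj_cis !opprK.
rewrite tr_mx4 !mul_mx4 /mkseq /=; simp4.
rewrite K K3 N E addNr addrA addNr add0r subrr mulrN.
by rewrite mulrA mulrAC K mul1r addNr.
Qed.

Definition B_0 (a : R) : 'M[C]_4 := M0 R *m conj_mx (M2_0 a).

Lemma B_0E a : B_0 a =
  mx4 [:: [:: 0;             0;               0;              1];
          [:: 0;       cis a;               0; conjc (uC a)];
          [:: 0;             0; - cis (a / 3);              0];
          [:: 1; conjc (uC a);               0;    - cis a]].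
Proof.
rewrite /B_0 mx4_conj /= !conjc0 !conjc1 !conjN !conj_cis !opprK.
by rewrite mul_mx4 /mkseq /=; simp4.
Qed.

Lemma B_0_cube a : 0 <= cos a -> B_0 a *m B_0 a *m B_0 a = (- cis a)%:M.
Proof.
move=> a0; rewrite B_0E; have N := uC_norm a0; have K := cisNK a.
have D : cis (a / 3) * cis (a / 3) * cis (a / 3) = cis a.
  by rewrite -!cisD; congr cis; field.
set v := conjc (uC a) in N *; set c := cis a in N K D *.
have V : v * v + c * c + 1 = 0.
  have -> : v * v = - (uC a * v) * c by rewrite {1}/v uC_conj -/c; ring.
  rewrite N -K; ring.
have V1 : 1 + v * v + c * c = 0 by rewrite -V; ring.
have V2 : c * c + v * v = -1.
  by apply/eqP; rewrite -addr_eq0 -V; apply/eqP; ring.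
rewrite scalar_mx4 !mul_mx4 /mkseq /=; simp4; rewrite D.
by rewrite (mulrC c v) subrr V1 V2; simp4; rewrite subrr.
Qed.

Lemma A1E p : A1 p = Umx p.2 *m B_0 p.1 *m invmx (Umx p.2).
Proof.
rewrite /A1 /M2 /conj_mx !map_mxM map_invmx -!/(conj_mx _) conj_Umx.
by rewrite !mulmxA -Umx_M0.
Qed.

Lemma A1_cube p : 0 <= cos p.1 -> A1 p *m A1 p *m A1 p = (- cis p.1)%:M.
Proof.
move=> p0; have Uu := Umx_unit p.2.
rewrite A1E conjmx_cube // B_0_cube //.
by rewrite scalar_mxC -mulmxA mulmxV // mulmx1.
Qed.

Lemma A2E : A2 = M1 *m M0 R.
Proof. by rewrite /A2 conj_M0. Qed.

Lemma A2_sq : A2 *m A2 = 1%:M.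
Proof.
by rewrite A2E {1}M1_M0 mulmxA -(mulmxA (M0 R)) M1K mulmx1 M0K.
Qed.

Lemma A2A1 p : A2 *m A1 p = A0 p.
Proof. by rewrite A2E /A1 mulmxA -(mulmxA M1) M0K mulmx1. Qed.

Lemma square_cos_ge0 p : p \in square -> 0 <= cos p.1.
Proof.
move=> /set_mem[]; rewrite /= in_itv /= => /andP[p0 p1] _.
apply: cos_ge0_pihalf; rewrite p1 andbT.
by rewrite (le_trans _ p0) // oppr_le0 divr_ge0 ?pi_ge0.
Qed.

Lemma conj_U31 M : M \in @U31_set R -> conj_mx M \in @U31_set R.
Proof.
move=> /set_mem/U31P H; apply/mem_set/U31P; move: (congr1 (@conj_mx R 4 4) H).
by rewrite /conj_mx !map_mxM map_trmx -!/(conj_mx _) conj_M0.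
Qed.

Lemma M2_U31 p : p \in square -> M2 p \in @U31_set R.
Proof.
move=> /square_cos_ge0 p0; have U := Umx_U31 p.2.
exact: U31_mul (U31_mul U (M2_0_U31 p0)) (U31_inv U).
Qed.

Definition A_mx (p : R * R) (i : 'I_3) : 'M[C]_4 :=
  nth A2 [:: A0 p; A1 p; A2] i.

Lemma A_mx_U31 p : p \in square -> forall i, A_mx p i \in @U31_set R.
Proof.
move=> ps; have U := conj_U31 (M2_U31 ps).
case=> [[|[|[|//]]] ?]; rewrite /A_mx /=.
- exact: U31_mul M1_U31 U.
- exact: U31_mul M0_U31 U.
- exact: U31_mul M1_U31 (conj_U31 M0_U31).
Qed.

(* Outside the square, M2 need not preserve the Hermitian form. *)
Definition A_PU (p : square) (i : 'I_3) : PU31 R :=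
  PU_class (mkU31 (A_mx_U31 (valP p) i)).

Lemma A_PU_rels (p : square) :
  {in PSL2Z_rels, forall r, word_eval (A_PU p) r = 1%g}.
Proof.
have p0 := square_cos_ge0 (valP p).
pose B i := mkU31 (A_mx_U31 (valP p) i).
move=> r; rewrite !inE => /or3P[] /eqP -> /=; rewrite mulg1.
- rewrite -(PU_classM (B 2) (B 2)); apply/PU_class1P; exists 1; rewrite ?oner_eq0 //=.
  exact: A2_sq.
- rewrite mulgA -(PU_classM (B 1) (B 1)) -(PU_classM _ (B 1)); apply/PU_class1P; exists (- cis (\val p).1).
    by rewrite oppr_eq0; apply: contra_eq_neq (cisNK (\val p).1) => ->;
      rewrite mulr0 eq_sym oner_eq0.
  exact: A1_cube.
- rewrite mulgA -(PU_classM (B 2) (B 1)).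
  rewrite (_ : PU_class _ = A_PU p 0) ?mulgV //.
  by congr PU_class; apply/val_inj; exact: A2A1.
Qed.

Definition rho (p : square) : PSL2Z -> PU31 R := pres_lift (A_PU p).

HB.instance Definition _ (p : square) :=
  isMultiplicative.Build PSL2Z (PU31 R) (rho p) (pres_liftM (@A_PU_rels p)).

Lemma rho_gen (p : square) (i : 'I_3) :
  rho p (pres_gen PSL2Z_rels i) = A_PU p i.
Proof. exact: pres_lift_gen (@A_PU_rels p) i. Qed.

Definition discrete_rep (G : groupType) (f : G -> PU31 R) : Prop :=
  range f `<=` isolated (range f).

Definition discrete_faithful (G : groupType) (f : G -> PU31 R) : Prop :=
  discrete_rep f /\ injective f.

End Representation.

(* Main.v *)
Require Import Defs.
From mathcomp Require Import all_boot all_order all_algebra.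
From mathcomp Require Import all_classical all_reals all_analysis.
From mathcomp Require Import complex ring lra.
Set Implicit Arguments.
Unset Strict Implicit.
Unset Printing Implicit Defensive.
Import Order.TTheory GRing.Theory Num.Theory.
Import numFieldNormedType.Exports.
Local Open Scope classical_set_scope.
Local Open Scope ring_scope.

(** The proof is a ping-pong argument for the free product of the groups of
order 2 and 3 generated by [A2] and [A1].

Write <,> for the Hermitian form, z = (z_0, z_1, z_2, z_3), and let p_1 = e_0,
p_2 = e_3 and p_3 be the three isotropic points which [A1] permutes cyclically;
[A2] exchanges p_1 and p_2.  The numbers |<z,p_1>|^2 = |z_3|^2,
|<z,p_2>|^2 = |z_0|^2 and |<z,p_3>|^2 = |(A1 z)_3|^2 ([dist1], [dist2],
[dist3]) say which of the three points a negative vector z is closest to.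

At both corners the parabolic [A0 = A2 A1] acts on the orthogonal complement of
its invariant complex line through p_1 by a unitary map without eigenvalue 1,
and this persists nearby.  Hence [A0] fixes p_1 and preserves such a complex
line, on which it is a translation.  Let [ht z] = Im (phi(z) conj z_3), where
phi is the linear form z_0 + axis1 z_1 + axis2 z_2, the product with a second
vector spanning that line together with p_1.  It is preserved by [A0] up to a
multiple of z_3, and [ht (A0 z) = ht z - s |z_3|^2] exactly, with a length s
close to 1 ([ht_A0]).

The set [sector] consists of the negative z with [ht z <= 0] when z is closer to
p_1 than to p_2, and with [0 <= ht (A2 z)] when it is closer to p_2.  The
boundary is thus adapted to the parabolic fixing p_1 near p_1 and to the one
fixing p_2 near p_2.  By construction [A2] maps the complement of [sector] into
[sector] ([sector_A2]).  The sets [sector], [A1 sector] and [A1^2 sector] are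
pairwise disjoint ([sector_A1], [sector_A1A1]).  Indeed each is associated with
a side of the ideal triangle p_1 p_2 p_3, and is empty over the region closest
to the opposite vertex.  This is an estimate with room to spare, hence stable
under perturbation ([horospheric_margin], [sector_margin]).  So a point common
to [sector] and [A1^-1 sector] is strictly closest to p_1, the common vertex of
the two sides, where the two sets are [ht <= 0] and [ht >= s |z_3|^2], which are
disjoint.

The open set [fund] of the negative z that are strictly closest to p_1 and
satisfy 0 < ht z < s |z_3|^2 is nonempty, and every nontrivial group element
moves it off itself, by the normal form in the free product ([normalP],
[fund_disjoint]).  Faithfulness and discreteness follow. *)

(** * Squared moduli and the estimate over the opposite vertex *)

Section NormSq.
Context (R : realType).
Implicit Types x y z w : R[i].

(** The squared modulus |z|^2, as a real number. *)
Definition nsq z : R := complex.Re z ^+ 2 + complex.Im z ^+ 2.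

Lemma nsq_ge0 z : 0 <= nsq z.
Proof. by rewrite addr_ge0 // sqr_ge0. Qed.

Lemma nsqM x y : nsq (x * y) = nsq x * nsq y.
Proof. by case: x y => [a b] [c d]; rewrite /nsq /=; ring. Qed.

Lemma nsqN x : nsq (- x) = nsq x.
Proof. by case: x => [a b]; rewrite /nsq /=; ring. Qed.

Lemma nsq_conj x : nsq (conjc x) = nsq x.
Proof. by case: x => [a b]; rewrite /nsq /=; ring. Qed.

Lemma nsq_real (a : R) : nsq a%:C%C = a ^+ 2.
Proof. by rewrite /nsq /=; ring. Qed.

Lemma nsq_eq0 x : (nsq x == 0) = (x == 0).
Proof.
case: x => a b; rewrite /nsq /= paddr_eq0 ?sqr_ge0 // !sqrf_eq0.
by rewrite eq_complex.
Qed.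

Lemma nsq_le1D x : nsq x = 1 -> nsq (1 + x) <= 4 /\ nsq (1 - x) <= 4.
Proof.
by case: x => a b; rewrite /nsq /= => H; split;
  have := sqr_ge0 (1 - a); have := sqr_ge0 (1 + a); nra.
Qed.

(** Weighted parallelogram inequality, for perturbing x by a small w. *)
Lemma nsq_split x w : nsq x <= 11 / 10 * nsq (x + w) + 11 * nsq w.
Proof.
case: x w => a b [c d]; rewrite /nsq /=.
have := sqr_ge0 (a + 11 * c); have := sqr_ge0 (b + 11 * d); nra.
Qed.

Lemma nsq_cauchy a b z w :
  nsq (a * z + b * w) <= (nsq a + nsq b) * (nsq z + nsq w).
Proof.
have -> : (nsq a + nsq b) * (nsq z + nsq w) =
    nsq (a * z + b * w) + nsq (a * conjc w - b * conjc z).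
  by case: a b z w => ? ? [? ?] [? ?] [? ?]; rewrite /nsq /=; ring.
by rewrite lerDl nsq_ge0.
Qed.

Lemma Im_mul_conj_le w z :
  `|complex.Im (w * conjc z)| <= 4 * nsq w + nsq z / 16.
Proof.
case: w z => a b [c d]; rewrite /nsq /= ler_norml.
have := sqr_ge0 (8 * a + d); have := sqr_ge0 (8 * a - d).
have := sqr_ge0 (8 * b + c); have := sqr_ge0 (8 * b - c).
by nra.
Qed.

(** A negative vector satisfies |z_1|^2 + |z_2|^2 < -2 Re (z_0 conj z_3)
<= |z_0|^2 + |z_3|^2, so the terms in z_1 and z_2 with small coefficients are
negligible.  Without them, if |z_0 - c z_3| is at most |z_0| and |z_3|, then
expanding |z_0 - c z_3|^2 bounds Re (conj c z_0 conj z_3) from below, and only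
the imaginary part of z_0 conj z_3 can contribute positively to it. *)
Lemma horospheric_margin (z0 z1 z2 z3 a b d1 d2 c : R[i]) :
  nsq c = 1 -> 0 <= complex.Re c -> 0 <= complex.Im c ->
  nsq d1 + nsq d2 <= 1 / 1000 -> nsq a + nsq b <= 2 / 125 ->
  2 * complex.Re (z0 * conjc z3) + nsq z1 + nsq z2 < 0 ->
  nsq (z0 + d1 * z1 + d2 * z2 - c * z3) <= nsq z0 ->
  nsq (z0 + d1 * z1 + d2 * z2 - c * z3) <= nsq z3 ->
  0 < complex.Im ((z0 + a * z1 + b * z2) * conjc z3) /\
  complex.Im ((z3 - a * z1 + b * z2) * conjc z0) < 0.
Proof.
move=> nc rc ic dle able J le0 le3.
rewrite -addrA in J; set T := nsq z0 + nsq z3; set P := nsq z1 + nsq z2 in J *.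
set w := d1 * z1 + d2 * z2.
have P0 : 0 <= P by rewrite addr_ge0 ?nsq_ge0.
have X0 := nsq_ge0 z0; have Y0 := nsq_ge0 z3.
have rT : - 2 * complex.Re (z0 * conjc z3) <= T.
  have := nsq_ge0 (z0 + z3); rewrite /T /nsq; case: (z0) (z3) => ? ? [? ?] /=; lra.
have PT : P < T by lra.
have r0 : complex.Re (z0 * conjc z3) < 0 by lra.
have wle : nsq w <= T / 1000.
  apply: le_trans (nsq_cauchy _ _ _ _) _.
  apply: le_trans (ler_wpM2r P0 dle) _; lra.
(* Both signs of a occur in the two conclusions. *)
have pert (s : R[i]) : s = a \/ s = - a -> nsq (s * z1 + b * z2) <= 2 / 125 * T.
  move=> sa; have ns : nsq s = nsq a by case: sa => ->; rewrite ?nsqN.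
  apply: le_trans (nsq_cauchy _ _ _ _) _; rewrite ns.
  apply: le_trans (ler_wpM2r P0 able) _; lra.
have q0 := nsq_split (z0 - c * z3) w.
have qE : z0 - c * z3 + w = z0 + d1 * z1 + d2 * z2 - c * z3 by rewrite /w; ring.
rewrite qE in q0.
have q1 : nsq (z0 - c * z3) <= 561 / 1000 * T by rewrite /T in wle *; lra.
have q2 : nsq (z0 - c * z3) = T - 2 * (complex.Re c * complex.Re (z0 * conjc z3) +
    complex.Im c * complex.Im (z0 * conjc z3)).
  transitivity (nsq z0 + nsq c * nsq z3 - 2 * (complex.Re c * complex.Re (z0 * conjc z3) +
    complex.Im c * complex.Im (z0 * conjc z3))); last by rewrite nc mul1r.
  by case: (z0) (z3) (c) => ? ? [? ?] [? ?]; rewrite /nsq /=; ring.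
have cr : complex.Re c * complex.Re (z0 * conjc z3) <= 0.
  by rewrite mulr_ge0_le0 // ltW.
have ic1 : complex.Im c <= 1.
  by move: nc; rewrite /nsq => nc; have := sqr_ge0 (complex.Re c); nra.
set ii := complex.Im (z0 * conjc z3) in q2 *.
have iT : 219 / 1000 * T <= ii.
  have : 219 / 1000 * T <= complex.Im c * ii by lra.
  move=> h; apply: (le_trans h).
  have ii0 : 0 <= ii by rewrite leNgt; apply/negP => ?; nra.
  by rewrite ler_piMl.
have YT : nsq z3 <= T by rewrite /T lerDr.
have XT : nsq z0 <= T by rewrite /T lerDl.
split.
- have := Im_mul_conj_le (a * z1 + b * z2) z3.
  have := pert a (or_introl erefl) => ? /ler_normlP[h _].
  have -> : complex.Im ((z0 + a * z1 + b * z2) * conjc z3) =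
      ii + complex.Im ((a * z1 + b * z2) * conjc z3).
    by rewrite -addrA mulrDl raddfD.
  by lra.
- have := Im_mul_conj_le (- a * z1 + b * z2) z0.
  have := pert (- a) (or_intror erefl) => ? /ler_normlP[_ h].
  have -> : complex.Im ((z3 - a * z1 + b * z2) * conjc z0) =
      - ii + complex.Im ((- a * z1 + b * z2) * conjc z0).
    rewrite -addrA mulrDl raddfD mulNr; congr (_ + _).
    by rewrite /ii; case: (z0) (z3) => ? ? [? ?] /=; ring.
  by lra.
Qed.

End NormSq.

(** * The generators in coordinates and the axis of the parabolic *)

Section Action.
Context (R : realType).
Local Notation C := R[i].
Implicit Types (p : R * R) (z w : 'cV[C]_4).

Lemma mx4_act (s : seq (seq C)) z (i : 'I_4) :
  (mx4 s *m z) i 0 = nth 0 (nth [::] s i) 0 * z 0 0 + nth 0 (nth [::] s i) 1 * z 1 0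
    + nth 0 (nth [::] s i) 2 * z 2 0 + nth 0 (nth [::] s i) 3 * z 3 0.
Proof. by rewrite mxE big_ord4 !mxE. Qed.

Lemma A2_act z :
  [/\ (A2 R *m z) 0 0 = z 3 0, (A2 R *m z) 1 0 = - z 1 0,
      (A2 R *m z) 2 0 = z 2 0 & (A2 R *m z) 3 0 = z 0 0].
Proof.
rewrite A2E /M1 /M0 mul_mx4 /mkseq /= !mx4_act /=; split; ring.
Qed.

Local Notation e p := (cis (p.1 / 3)).
Local Notation c p := (cis p.1).
Local Notation v p := (conjc (uC p.1)).
Local Notation co p := ((cos p.2)%:C%C : C).
Local Notation si p := ((sin p.2)%:C%C : C).

Lemma invmx_Umx (b : R) : invmx (Umx b) = (Umx b)^T.
Proof. by rewrite -[LHS]mul1mx -(Umx_tr b) mulmxK ?Umx_unit. Qed.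

(** Here [cis (p.1 / 3)] is a cube root of [cis p.1]. *)
Lemma A1_act p z :
  [/\ (A1 p *m z) 0 0 = z 3 0,
      (A1 p *m z) 1 0 = (c p * co p ^+ 2 - e p * si p ^+ 2) * z 1 0
        + (c p + e p) * co p * si p * z 2 0 + v p * co p * z 3 0,
      (A1 p *m z) 2 0 = (c p + e p) * co p * si p * z 1 0
        + (c p * si p ^+ 2 - e p * co p ^+ 2) * z 2 0 + v p * si p * z 3 0 &
      (A1 p *m z) 3 0 = z 0 0 + v p * co p * z 1 0 + v p * si p * z 2 0 - c p * z 3 0].
Proof.
rewrite A1E invmx_Umx B_0E /Umx tr_mx4 /mkseq !mul_mx4 /mkseq !mx4_act.
move: (c p) (e p) (v p) (co p) (si p) => c e v co si /=.
by split; ring.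
Qed.

Lemma cosi2 p : co p ^+ 2 + si p ^+ 2 = 1.
Proof. by rewrite !expr2 real_sqD. Qed.

Lemma c_e p : c p = e p ^+ 3.
Proof. by rewrite !exprS expr0 mulr1 -!cisD; congr cis; field. Qed.

Lemma nsq_cis (t : R) : nsq (cis t) = 1.
Proof. by rewrite /nsq /= cos2Dsin2. Qed.

Lemma v_sq p : 0 <= cos p.1 -> v p ^+ 2 = - (c p ^+ 2 + 1).
Proof.
move=> a0; have N := uC_norm a0; have K := cisNK p.1.
have -> : v p ^+ 2 = - (uC p.1 * v p) * c p by rewrite {1}expr2 {1}uC_conj; ring.
by rewrite N; ring: K.
Qed.

Lemma nsq_mul_conj (x : C) : (nsq x)%:C%C = x * conjc x.
Proof. by case: x => x y; rewrite /nsq /=; simpc; congr (_ +i* _)%C => /=; ring. Qed.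

Lemma nsq_v p : 0 <= cos p.1 -> nsq (v p) = 2 * cos p.1.
Proof.
move=> a0; apply: complexI; rewrite -cisDN -(uC_norm a0) nsq_conj.
exact: nsq_mul_conj.
Qed.

(** The determinant of 1 - W, with W the unitary action of [A0] on
the middle coordinates z_1 and z_2, is [2 * cis (2 * p.1 / 3) * turn_den p]
(this is [detC], see [detCE]); it is nonzero exactly when W has no eigenvalue 1.
In that case [cusp_shift] is the length by which [A0] translates along
its invariant complex line. *)
Definition turn_den p : R := cos (p.1 / 3 *+ 2) + cos (p.2 *+ 2) * cos (p.1 / 3).
Definition turn_num p : R := sin (p.1 / 3) + cos (p.2 *+ 2) * sin (p.1 / 3 *+ 2).
Definition cusp_shift p : R := turn_num p / turn_den p.

Definition detC p : C := 2 * e p ^+ 2 * (turn_den p)%:C%C.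

(** The coefficients of the linear form z_0 + axis1 z_1 + axis2 z_2 that [A0]
preserves modulo z_3. *)
Definition axis1 p : C := v p * co p * (1 + e p) / detC p.
Definition axis2 p : C := v p * si p * (1 - e p) / detC p.

(** The unnormalised height of z along the complex line preserved by [A0]. *)
Definition ht p z : R :=
  complex.Im ((z 0 0 + axis1 p * z 1 0 + axis2 p * z 2 0) * conjc (z 3 0)).

Lemma cos2C p : (cos (p.2 *+ 2))%:C%C = co p ^+ 2 - si p ^+ 2 :> C.
Proof.
rewrite cos_mulr2n -!rmorphXn -rmorphB /=; congr (_%:C)%C.
by have := cos2Dsin2 p.2; lra.
Qed.

Lemma detCE p :
  detC p = 1 + c p * e p + (co p ^+ 2 - si p ^+ 2) * (c p + e p).
Proof.
have [E E2] := (cisDN (p.1 / 3), cisDN (p.1 / 3 *+ 2)).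
have K := cisNK (p.1 / 3).
rewrite /detC /turn_den rmorphD rmorphM /= cos2C.
have -> : 2 * e p ^+ 2 * ((cos (p.1 / 3 *+ 2))%:C%C + (co p ^+ 2 - si p ^+ 2) *
   (cos (p.1 / 3))%:C%C) = e p ^+ 2 * ((2 * cos (p.1 / 3 *+ 2))%:C%C +
   (co p ^+ 2 - si p ^+ 2) * (2 * cos (p.1 / 3))%:C%C) by rewrite !rmorphM /=; ring.
rewrite -E -E2 c_e mulr2n opprD !cisD.
by move: K; move: (e p) (cis (- _)) => x y K; ring: K.
Qed.

(** The next three lemmas compare the coefficients of z_1, z_2 and z_3 in the
invariance of that linear form under [A0]. *)
Lemma axis_coef1 p : detC p != 0 ->
  v p * co p - axis1 p * (c p * co p ^+ 2 - e p * si p ^+ 2)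
    + axis2 p * ((c p + e p) * co p * si p) = axis1 p.
Proof.
move=> d0; have vE : v p = v p / detC p * detC p by rewrite divfK.
have D := detCE p; have S := cosi2 p; rewrite /axis1 /axis2.
have -> : v p * co p * (1 + e p) / detC p = (v p / detC p) * co p * (1 + e p) by ring.
have -> : v p * si p * (1 - e p) / detC p = (v p / detC p) * si p * (1 - e p) by ring.
rewrite {1}vE; move: (v p / detC p) => k; rewrite D.
have S' : si p ^+ 2 = 1 - co p ^+ 2 by rewrite -S; ring.
ring: S'.
Qed.

Lemma axis_coef2 p : detC p != 0 ->
  v p * si p - axis1 p * ((c p + e p) * co p * si p)
    + axis2 p * (c p * si p ^+ 2 - e p * co p ^+ 2) = axis2 p.
Proof.
move=> d0; have vE : v p = v p / detC p * detC p by rewrite divfK.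
have D := detCE p; have S := cosi2 p; rewrite /axis1 /axis2.
have -> : v p * co p * (1 + e p) / detC p = (v p / detC p) * co p * (1 + e p) by ring.
have -> : v p * si p * (1 - e p) / detC p = (v p / detC p) * si p * (1 - e p) by ring.
rewrite {1}vE; move: (v p / detC p) => k; rewrite D.
have S' : si p ^+ 2 = 1 - co p ^+ 2 by rewrite -S; ring.
ring: S'.
Qed.

Lemma turn_numC p : 2 * e p ^+ 2 * ('i%C * (turn_num p)%:C%C) =
  c p - e p + (co p ^+ 2 - si p ^+ 2) * (c p * e p - 1).
Proof.
have sE (t : R) : cis t - cis (- t) = 2 * 'i%C * (sin t)%:C%C.
  rewrite /cis cosN sinN; apply/eqP; rewrite eq_complex /=.
  by apply/andP; split; apply/eqP; ring.
have [E E2] := (sE (p.1 / 3), sE (p.1 / 3 *+ 2)).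
have K := cisNK (p.1 / 3).
rewrite /turn_num rmorphD rmorphM /= cos2C.
transitivity (e p ^+ 2 * (2 * 'i%C * (sin (p.1 / 3))%:C%C +
   (co p ^+ 2 - si p ^+ 2) * (2 * 'i%C * (sin (p.1 / 3 *+ 2))%:C%C))); first ring.
rewrite -E -E2 c_e mulr2n opprD !cisD.
by move: K; move: (e p) (cis (- _)) => x y K; ring: K.
Qed.

Lemma axis_coef3 p : 0 <= cos p.1 -> turn_den p != 0 ->
  - c p - axis1 p * (v p * co p) + axis2 p * (v p * si p) = - 'i%C * (cusp_shift p)%:C%C.
Proof.
move=> a0 d0.
have e0 : e p != 0 by rewrite -nsq_eq0 nsq_cis oner_eq0.
have t0 : (turn_den p)%:C%C != 0 :> C by rewrite -nsq_eq0 nsq_real sqrf_eq0.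
have D0 : detC p != 0 by rewrite !mulf_neq0 // ?expf_neq0 // pnatr_eq0.
apply: (mulIf D0).
have -> : - 'i%C * (cusp_shift p)%:C%C * detC p =
    - (2 * e p ^+ 2 * ('i%C * (turn_num p)%:C%C)).
  by rewrite /cusp_shift /detC rmorphM fmorphV /=; field.
rewrite turn_numC.
have -> : (- c p - axis1 p * (v p * co p) + axis2 p * (v p * si p)) * detC p =
    - c p * detC p + v p ^+ 2 * (si p ^+ 2 * (1 - e p) - co p ^+ 2 * (1 + e p)).
  by rewrite /axis1 /axis2; field.
rewrite v_sq // detCE; have S := cosi2 p.
have -> : si p ^+ 2 = 1 - co p ^+ 2 by rewrite -S; ring.
ring.
Qed.

(** The parabolic [A0 = A2 A1] lowers the height by an exact amount. *)
Lemma ht_A0 p z : 0 <= cos p.1 -> turn_den p != 0 ->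
  ht p (A2 R *m (A1 p *m z)) = ht p z - cusp_shift p * nsq (z 3 0).
Proof.
move=> a0 d0.
have e0 : e p != 0 by rewrite -nsq_eq0 nsq_cis oner_eq0.
have t0 : (turn_den p)%:C%C != 0 :> C by rewrite -nsq_eq0 nsq_real sqrf_eq0.
have D0 : detC p != 0 by rewrite !mulf_neq0 // ?expf_neq0 // pnatr_eq0.
have [B0 B1 B2 B3] := A2_act (A1 p *m z); have [C0 C1 C2 C3] := A1_act p z.
have [k1 k2 k3] := And3 (axis_coef1 D0) (axis_coef2 D0) (axis_coef3 a0 d0).
rewrite /ht B0 B1 B2 B3 C0 C1 C2 C3.
have -> : z 0 0 + v p * co p * z 1 0 + v p * si p * z 2 0 - c p * z 3 0 +
  axis1 p * - ((c p * co p ^+ 2 - e p * si p ^+ 2) * z 1 0 +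
    (c p + e p) * co p * si p * z 2 0 + v p * co p * z 3 0) +
  axis2 p * ((c p + e p) * co p * si p * z 1 0 +
    (c p * si p ^+ 2 - e p * co p ^+ 2) * z 2 0 + v p * si p * z 3 0) =
  (z 0 0 + axis1 p * z 1 0 + axis2 p * z 2 0) - 'i%C * (cusp_shift p)%:C%C * z 3 0.
  have -> : - ('i%C * (cusp_shift p)%:C%C * z 3 0) = - 'i%C * (cusp_shift p)%:C%C * z 3 0.
    by ring.
  rewrite -k3.
  transitivity (z 0 0 +
    (v p * co p - axis1 p * (c p * co p ^+ 2 - e p * si p ^+ 2)
      + axis2 p * ((c p + e p) * co p * si p)) * z 1 0 +
    (v p * si p - axis1 p * ((c p + e p) * co p * si p)
      + axis2 p * (c p * si p ^+ 2 - e p * co p ^+ 2)) * z 2 0 +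
    (- c p - axis1 p * (v p * co p) + axis2 p * (v p * si p)) * z 3 0); first ring.
  by rewrite k1 k2.
rewrite mulrBl raddfB /=; congr (_ - _).
by case: (z 3 0) => x y; rewrite /nsq /=; ring.
Qed.

Lemma nsq_axis p : 0 <= cos p.1 -> 1 / 16 <= turn_den p ^+ 2 ->
  nsq (axis1 p) + nsq (axis2 p) <= 16 * nsq (v p).
Proof.
move=> a0 d0.
have dg : 0 < turn_den p ^+ 2 by lra.
have nd : nsq (detC p) = 4 * turn_den p ^+ 2.
  rewrite /detC !nsqM nsq_real nsq_cis !mulr1; congr (_ * _).
  by rewrite /nsq /=; ring.
have nV (x : C) : nsq x^-1 = (nsq x)^-1.
  have [->|x0] := eqVneq x 0; first by rewrite invr0 /nsq /= expr0n addr0 invr0.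
  apply: (@mulfI _ (nsq x)); first by rewrite nsq_eq0.
  by rewrite -nsqM !mulfV ?nsq_eq0 // /nsq /= expr0n addr0 expr1n.
have [h1 h2] := nsq_le1D (nsq_cis (p.1 / 3)).
rewrite /axis1 /axis2 !nsqM nV nd !nsq_real -mulrDl ler_pdivrMr; last by lra.
have V0 := nsq_ge0 (v p).
apply: (@le_trans _ _ (nsq (v p) * 4)).
  rewrite -!(mulrA (nsq _)) -mulrDr ler_wpM2l //.
  have := cos2Dsin2 p.2; have := sqr_ge0 (cos p.2); have := sqr_ge0 (sin p.2); nra.
have -> : 16 * nsq (v p) * (4 * turn_den p ^+ 2) =
    nsq (v p) * (64 * turn_den p ^+ 2) by ring.
by rewrite ler_wpM2l //; lra.
Qed.

End Action.

(** * Ping-pong on negative vectors *)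

Section PingPong.
Context (R : realType).
Local Notation C := R[i].
Implicit Types (p : R * R) (z w : 'cV[C]_4).

(** The Hermitian square of z, which is real; negative vectors are those with
[hnorm z < 0]. *)
Definition hnorm z : R :=
  2 * complex.Re (z 0 0 * conjc (z 3 0)) + nsq (z 1 0) + nsq (z 2 0).

Lemma hermC z : herm z z = (hnorm z)%:C%C.
Proof.
rewrite /herm /hnorm /nsq.
case: (z 0 0) (z 1 0) (z 2 0) (z 3 0) => a b [c d] [e f] [g h].
by apply/eqP; rewrite eq_complex /=; apply/andP; split; apply/eqP; ring.
Qed.

Lemma hnorm_U31 (A : 'M[C]_4) z : A \in @U31_set R -> hnorm (A *m z) = hnorm z.
Proof. by move=> /set_mem UA; apply: complexI; rewrite -!hermC UA. Qed.

(** The squared moduli of the products of z with the three isotropic vectors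
permuted by [A1]. *)
Definition dist1 z : R := nsq (z 3 0).
Definition dist2 z : R := nsq (z 0 0).
Definition dist3 p z : R := nsq ((A1 p *m z) 3 0).

(** Explicit conditions that hold at and around both corners: [2 * cos p.1] is
the squared modulus of the off-diagonal entry of [M2_0], the bound on [turn_den]
keeps [axis1] and [axis2] small, and [1 / 2] is the height of [base_point]. *)
Definition near_corner p : Prop :=
  [/\ p \in @square R, 0 <= sin p.1, cos p.1 <= 1 / 2000,
      1 / 16 <= turn_den p ^+ 2 & 1 / 2 < cusp_shift p].

(** The ping-pong set attached to the side p_1 p_2 of the ideal triangle. *)
Definition sector p : set 'cV[C]_4 := [set z | hnorm z < 0 /\
  (dist1 z <= dist2 z /\ ht p z <= 0 \/
   dist2 z <= dist1 z /\ 0 <= ht p (A2 R *m z))].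

(** Negative vectors strictly closest to p_1 whose height lies strictly between
those of the two sides at p_1. *)
Definition fund p : set 'cV[C]_4 := [set z |
  [/\ hnorm z < 0, dist1 z < dist2 z, dist1 z < dist3 p z,
      0 < ht p z & ht p z < cusp_shift p * dist1 z]].

Lemma A2_U31 : A2 R \in @U31_set R.
Proof. exact: U31_mul (M1_U31 _) (conj_U31 (M0_U31 _)). Qed.

Section Fixed.
Context p (hp : near_corner p).

Let ps : p \in @square R. Proof. by case: hp. Qed.
Let a0 : 0 <= cos p.1. Proof. exact: square_cos_ge0 ps. Qed.
Let d0 : turn_den p != 0.
Proof. by case: hp => _ _ _ d _; rewrite -sqrf_eq0 gt_eqF //; lra. Qed.

Let A1_U31 : A1 p \in @U31_set R. Proof. exact: A_mx_U31 ps 1. Qed.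

Lemma dist1_A2 z : dist1 (A2 R *m z) = dist2 z.
Proof. by rewrite /dist1; have [_ _ _ ->] := A2_act z. Qed.

Lemma dist2_A2 z : dist2 (A2 R *m z) = dist1 z.
Proof. by rewrite /dist2; have [-> _ _ _] := A2_act z. Qed.

Lemma dist1_A1 z : dist1 (A1 p *m z) = dist3 p z.
Proof. by []. Qed.

Lemma dist2_A1 z : dist2 (A1 p *m z) = dist1 z.
Proof. by rewrite /dist2; have [-> _ _ _] := A1_act p z. Qed.

Lemma A1_cube_act z : A1 p *m (A1 p *m (A1 p *m z)) = - cis p.1 *: z.
Proof. by rewrite (mulmxA (A1 p)) (mulmxA (A1 p *m A1 p)) A1_cube // mul_scalar_mx. Qed.

Lemma dist3_A1 z : dist3 p (A1 p *m z) = dist2 z.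
Proof.
rewrite /dist3 -/(dist1 _) -dist2_A1 A1_cube_act /dist2 mxE nsqM nsqN nsq_cis.
by rewrite mul1r.
Qed.

Lemma A2K z : A2 R *m (A2 R *m z) = z.
Proof. by rewrite mulmxA A2_sq mul1mx. Qed.

(** Over the region closest to p_3 the heights seen from p_1 and p_2 have the
signs that [sector] excludes. *)
Lemma sector_margin z : hnorm z < 0 -> dist3 p z <= dist1 z -> dist3 p z <= dist2 z ->
  0 < ht p z /\ ht p (A2 R *m z) < 0.
Proof.
move=> J; case: hp => _ s0 c0 dn _.
have nv := nsq_v a0; have na := nsq_axis a0 dn.
have [_ _ _ E] := A1_act p z; have [B0 B1 B2 B3] := A2_act z.
rewrite /dist3 E /dist1 /dist2 => le1 le2.
have [] := @horospheric_margin R (z 0 0) (z 1 0) (z 2 0) (z 3 0) (axis1 p) (axis2 p)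
  (conjc (uC p.1) * (cos p.2)%:C%C) (conjc (uC p.1) * (sin p.2)%:C%C) (cis p.1) => //.
- exact: nsq_cis.
- by rewrite !nsqM !nsq_real -mulrDr cos2Dsin2 nv; lra.
- by rewrite nv in na; lra.
- by rewrite /ht B0 B1 B2 B3 => h1 h2; split=> //; rewrite mulrN.
Qed.

Lemma sector_A2 z : hnorm z < 0 -> ~ sector p z -> sector p (A2 R *m z).
Proof.
move=> J nz; split; first by rewrite (hnorm_U31 _ A2_U31).
rewrite dist1_A2 dist2_A2 A2K.
have [le12|lt21] := leP (dist1 z) (dist2 z).
  right; split=> //; rewrite leNgt; apply/negP => h; apply: nz; split=> //.
  by left; split=> //; exact: ltW.
left; split; first exact: ltW.
rewrite leNgt; apply/negP => h; apply: nz; split=> //.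
by right; split; exact: ltW.
Qed.

Lemma sector_dist3 z : sector p z -> dist1 z < dist3 p z \/ dist2 z < dist3 p z.
Proof.
move=> [J h]; have [le1|lt1] := leP (dist3 p z) (dist1 z); last by left.
have [le2|lt2] := leP (dist3 p z) (dist2 z); last by right.
have [] := sector_margin J le1 le2; case: h => -[_ h] h1 h2; lra.
Qed.

Lemma dist1_gt0 z : hnorm z < 0 -> 0 < dist1 z.
Proof.
rewrite /dist1 => J; rewrite lt0r nsq_ge0 nsq_eq0 andbT; apply/eqP => z3.
move: J; rewrite /hnorm z3 conjc0 mulr0 /= mulr0 add0r.
by rewrite ltNge addr_ge0 ?nsq_ge0.
Qed.

Lemma sector_A1 z : sector p z -> ~ sector p (A1 p *m z).
Proof.
move=> h h'; have g3 := sector_dist3 h; have g2 := sector_dist3 h'.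
rewrite dist1_A1 dist2_A1 dist3_A1 in g2.
have [_ _ _ _ sh] := hp.
have [J hz] := h; have := dist1_gt0 J => d1.
have l12 : dist1 z < dist2 z by case: g2 => // g2; case: g3 => g3; lra.
have l13 : dist1 z < dist3 p z by case: g3 => // g3; lra.
case: hz => -[hd hz]; last lra.
case: h' => _; rewrite dist1_A1 dist2_A1 => -[] [hd' hz']; first lra.
by move: hz'; rewrite ht_A0 // -/(dist1 z); nra.
Qed.

Lemma dist1Z (c : C) z : dist1 (c *: z) = nsq c * dist1 z.
Proof. by rewrite /dist1 mxE nsqM. Qed.
Lemma dist2Z (c : C) z : dist2 (c *: z) = nsq c * dist2 z.
Proof. by rewrite /dist2 mxE nsqM. Qed.
Lemma dist3Z (c : C) z : dist3 p (c *: z) = nsq c * dist3 p z.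
Proof. by rewrite /dist3 -scalemxAr mxE nsqM. Qed.

Lemma htZ (c : C) z : ht p (c *: z) = nsq c * ht p z.
Proof.
rewrite /ht !mxE; set x := z 0 0 + _ + _; move: (z 3 0) => y.
have -> : c * z 0 0 + axis1 p * (c * z 1 0) + axis2 p * (c * z 2 0) = c * x.
  by rewrite /x; ring.
by case: c x y => ? ? [? ?] [? ?]; rewrite /nsq /=; ring.
Qed.

Lemma hnormZ (c : C) z : hnorm (c *: z) = nsq c * hnorm z.
Proof.
rewrite /hnorm !mxE !nsqM; move: (z 0 0) (z 3 0) (nsq (z 1 0)) (nsq (z 2 0)) => x y s t.
by case: c x y => ? ? [? ?] [? ?]; rewrite /nsq /=; ring.
Qed.

Lemma sectorZ (c : C) z : c != 0 -> sector p z -> sector p (c *: z).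
Proof.
rewrite -nsq_eq0 => c0; have cp : 0 < nsq c by rewrite lt0r c0 nsq_ge0.
rewrite /sector /= -scalemxAr !dist1Z !dist2Z !htZ hnormZ !ler_pM2l //.
by rewrite !pmulr_rle0 ?pmulr_rge0 ?pmulr_rlt0.
Qed.

Lemma fundZ (c : C) z : c != 0 -> fund p z -> fund p (c *: z).
Proof.
rewrite -nsq_eq0 => c0; have cp : 0 < nsq c by rewrite lt0r c0 nsq_ge0.
rewrite /fund /= !dist1Z !dist2Z dist3Z !htZ hnormZ mulrCA !ltr_pM2l //.
by rewrite pmulr_rgt0 ?pmulr_rlt0.
Qed.

Lemma sector_A1A1 z : sector p z -> ~ sector p (A1 p *m (A1 p *m z)).
Proof.
move=> h h'; apply: (sector_A1 h'); rewrite A1_cube_act; apply: sectorZ => //.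
by rewrite oppr_eq0 -nsq_eq0 nsq_cis oner_eq0.
Qed.

Lemma fund_sector z : fund p z -> ~ sector p z.
Proof. by move=> [J l12 l13 h0 h1] [_ []] [] *; lra. Qed.

Lemma fund_sector_A1 z : fund p z -> ~ sector p (A1 p *m z).
Proof.
move=> [J l12 l13 h0 h1] [_]; rewrite dist1_A1 dist2_A1 ht_A0 // -/(dist1 z).
by move=> [] [] *; lra.
Qed.

Lemma fund_sector_A1A1 z : fund p z -> ~ sector p (A1 p *m (A1 p *m z)).
Proof.
move=> [J l12 l13 _ _] /sector_dist3; rewrite dist3_A1 dist1_A1 dist3_A1.
by rewrite !dist2_A1 dist1_A1 => -[]; lra.
Qed.

Lemma hnorm_A1 z : hnorm (A1 p *m z) = hnorm z.
Proof. exact: hnorm_U31. Qed.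

Lemma fund_A1 z : fund p z -> ~ fund p (A1 p *m z).
Proof.
by move=> [_ _ l13 _ _] [_ + _ _ _]; rewrite dist1_A1 dist2_A1; lra.
Qed.

Lemma fund_A1A1 z : fund p z -> ~ fund p (A1 p *m (A1 p *m z)).
Proof.
move=> [_ l12 _ _ _] [_ _ + _ _].
by rewrite dist3_A1 dist1_A1 dist3_A1 dist2_A1; lra.
Qed.

(** A point of the fundamental set lying on the complex line spanned by p_1 and
p_2. *)
Definition base_point : 'cV[C]_4 :=
  \col_i nth 0 [:: (- 1 +i* (1 / 2))%C; 0; 0; 1] i.

Lemma fund_base : fund p base_point.
Proof.
have [_ _ _ _ sh] := hp.
have [z0 z1 z2 z3] : [/\ base_point 0 0 = (- 1 +i* (1 / 2))%C, base_point 1 0 = 0,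
  base_point 2 0 = 0 & base_point 3 0 = 1] by rewrite !mxE.
have [_ _ _ E] := A1_act p base_point.
rewrite /fund /= /hnorm /dist3 E /dist1 /dist2 /ht z0 z1 z2 z3.
rewrite !mulr0 !addr0 mulr1 conjc1 mulr1.
have hxy := cos2Dsin2 p.1; have hy := sin_le1 p.1.
rewrite /nsq /=; split; try nra.
by move: (cos p.1) (sin p.1) a0 hy hxy => x y x0 hy hxy; nra.
Qed.

End Fixed.
End PingPong.

(** * Openness of the fundamental set under the action *)

Section ComplexContinuity.
Context (R : realType).

Lemma Re_continuous : continuous (@complex.Re R : R[i] -> R).
Proof.
move=> x; have F : Filter (nbhs x) by exact: nbhs_filter.
apply/(@cvgrPdist_lt _ _ _ _ F) => e e0.
exists e%:C%C => /=; first by rewrite ltcR.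
move=> y; rewrite /ball /= => h; rewrite -ltcR; apply: le_lt_trans h.
by rewrite -raddfB; exact: normc_ge_Re.
Qed.

Lemma Im_continuous : continuous (@complex.Im R : R[i] -> R).
Proof.
move=> x; have F : Filter (nbhs x) by exact: nbhs_filter.
apply/(@cvgrPdist_lt _ _ _ _ F) => e e0.
exists e%:C%C => /=; first by rewrite ltcR.
move=> y; rewrite /ball /= => h; rewrite -ltcR; apply: le_lt_trans h.
rewrite -raddfB; case: (x - y) => a b /=.
by rewrite normc_def lecR -sqrtr_sqr ler_wsqrtr // lerDr sqr_ge0.
Qed.

(** Continuity of a complex-valued function, read on its real and imaginary
parts, so that real expressions in these parts are handled directly. *)
Definition ccontinuous (T : topologicalType) (f : T -> R[i]) :=
  continuous (fun x => complex.Re (f x)) /\ continuous (fun x => complex.Im (f x)).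

Section Ops.
Context (T : topologicalType).
Implicit Types f g : T -> R[i].

Lemma ccontinuous_cst (c : R[i]) : ccontinuous (fun _ : T => c).
Proof. by split=> x; exact: cvg_cst. Qed.

Lemma ccontinuousD f g :
  ccontinuous f -> ccontinuous g -> ccontinuous (fun x => f x + g x).
Proof.
move=> [f1 f2] [g1 g2]; split=> x.
  under eq_fun do rewrite raddfD; exact: cvgD (f1 x) (g1 x).
under eq_fun do rewrite raddfD; exact: cvgD (f2 x) (g2 x).
Qed.

Lemma ccontinuousM f g :
  ccontinuous f -> ccontinuous g -> ccontinuous (fun x => f x * g x).
Proof.
have ReM (x y : R[i]) : complex.Re (x * y) =
  complex.Re x * complex.Re y - complex.Im x * complex.Im y by case: x y => ? ? [].
have ImM (x y : R[i]) : complex.Im (x * y) =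
  complex.Re x * complex.Im y + complex.Im x * complex.Re y by case: x y => ? ? [].
move=> [f1 f2] [g1 g2]; split=> x.
  under eq_fun do rewrite ReM.
  exact: cvgB (cvgM (f1 x) (g1 x)) (cvgM (f2 x) (g2 x)).
under eq_fun do rewrite ImM.
exact: cvgD (cvgM (f1 x) (g2 x)) (cvgM (f2 x) (g1 x)).
Qed.

Lemma ccontinuous_conj f : ccontinuous f -> ccontinuous (fun x => conjc (f x)).
Proof.
move=> [f1 f2]; split=> x.
  rewrite (_ : (fun x => complex.Re _) = fun x => complex.Re (f x)); first exact: f1.
  by apply: funext => y; case: (f y).
rewrite (_ : (fun x => complex.Im _) = fun x => - complex.Im (f x)).
  exact: cvgN (f2 x).
by apply: funext => y; case: (f y).
Qed.

Lemma ccontinuous_nsq f : ccontinuous f -> continuous (fun x => nsq (f x)).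
Proof.
move=> [f1 f2] x; rewrite /nsq.
exact: cvgD (cvgM (f1 x) (f1 x)) (cvgM (f2 x) (f2 x)).
Qed.

Lemma add_continuous_fun (f g : T -> R) :
  continuous f -> continuous g -> continuous (fun x => f x + g x).
Proof. by move=> fc gc x; exact: cvgD (fc x) (gc x). Qed.

Lemma scale_continuous_fun (k : R) (f : T -> R) :
  continuous f -> continuous (fun x => k * f x).
Proof. by move=> fc x; apply: cvgM; [exact: cvg_cst|exact: fc]. Qed.

End Ops.

Lemma open_lt_fun (T : topologicalType) (f g : T -> R) :
  continuous f -> continuous g -> open [set x | f x < g x].
Proof.
move=> fc gc; rewrite (_ : [set x | f x < g x] =
    (fun x => g x - f x) @^-1` [set x | 0 < x]).
  apply: open_comp; last exact: open_gt.
  by move=> x _; exact: cvgB (gc x) (fc x).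
by apply/seteqP; split=> x /=; rewrite subr_gt0.
Qed.

End ComplexContinuity.

Section Discrete.
Context (R : realType).
Local Notation C := R[i].

Lemma entry_ccontinuous (i j : 'I_4) :
  ccontinuous (fun a : U31 R => (\val a : 'M[C]_4) i j).
Proof.
have h : continuous (fun a : U31 R => (\val a : 'M[C]_4) i j).
  move=> a; apply: (@continuous_comp _ _ _ (fun a : U31 R => \val a : 'M[C]_4)
    (fun M : 'M[C]_4 => M i j)); first exact: initial_continuous.
  exact: (@coord_continuous C).
split=> a; apply: (continuous_comp (h a)); [exact: Re_continuous|exact: Im_continuous].
Qed.

Lemma act_ccontinuous (v : 'cV[C]_4) (i : 'I_4) :
  ccontinuous (fun a : U31 R => (\val a *m v) i 0).
Proof.
under eq_fun do rewrite mxE big_ord4.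
by do !apply: ccontinuousD; apply: ccontinuousM;
  (exact: entry_ccontinuous || exact: ccontinuous_cst).
Qed.

Lemma open_fund (p : R * R) (v : 'cV[C]_4) :
  open [set a : U31 R | fund p (\val a *m v)].
Proof.
have act := act_ccontinuous v.
have hc : continuous (fun a : U31 R => hnorm (\val a *m v)).
  have [h _] := ccontinuousM (act 0) (ccontinuous_conj (act 3)).
  rewrite /hnorm; apply: add_continuous_fun; last exact: ccontinuous_nsq.
  apply: add_continuous_fun; last exact: ccontinuous_nsq.
  exact: scale_continuous_fun.
have d1c : continuous (fun a : U31 R => dist1 (\val a *m v)).
  exact: ccontinuous_nsq (act 3).
have d2c : continuous (fun a : U31 R => dist2 (\val a *m v)).
  exact: ccontinuous_nsq (act 0).
have d3c : continuous (fun a : U31 R => dist3 p (\val a *m v)).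
  apply: ccontinuous_nsq; under eq_fun do rewrite mxE big_ord4.
  by do !apply: ccontinuousD; apply: ccontinuousM;
    (exact: act || exact: ccontinuous_cst).
have htc : continuous (fun a : U31 R => ht p (\val a *m v)).
  have K (x : C) (f : U31 R -> C) :
      ccontinuous f -> ccontinuous (fun a : U31 R => x * f a).
    by move=> fc; exact: ccontinuousM (ccontinuous_cst _ _) fc.
  apply: (proj2 (ccontinuousM _ (ccontinuous_conj (act 3)))).
  exact: ccontinuousD (ccontinuousD (act 0) (K _ _ (act 1))) (K _ _ (act 2)).
have c0 : continuous (fun _ : U31 R => 0 : R) by exact: cst_continuous.
have sc : continuous (fun a : U31 R => cusp_shift p * dist1 (\val a *m v)).
  exact: scale_continuous_fun.
have := openI (open_lt_fun hc c0) (openI (open_lt_fun d1c d2c)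
  (openI (open_lt_fun d1c d3c) (openI (open_lt_fun c0 htc) (open_lt_fun htc sc)))).
congr open; apply/seteqP; split=> a /=; first by move=> [? [? [? []]]]; split.
by case.
Qed.

End Discrete.

(** * Normal forms in the modular group *)

Section NormalForm.
Local Open Scope group_scope.

Definition gen (i : 'I_3) : PSL2Z := pres_gen PSL2Z_rels i.

Lemma rel_eq1 (w : word 'I_3) :
  w \in PSL2Z_rels -> \pi_(presented PSL2Z_rels)%qT w = 1.
Proof.
move=> wr; apply/pres_piP; have := pres_rel [::] [::] wr.
by rewrite cats0.
Qed.

Lemma gen2_sq : gen 2%R * gen 2%R = 1.
Proof. by rewrite [LHS]pres_mulgE; apply: rel_eq1; rewrite in_cons eqxx. Qed.

Lemma gen1_cube : gen 1%R * (gen 1%R * gen 1%R) = 1.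
Proof.
rewrite [gen 1%R * gen 1%R]pres_mulgE [LHS]pres_mulgE; apply: rel_eq1.
by rewrite !in_cons eqxx orbT.
Qed.

Lemma gen0E : gen 0%R = gen 2%R * gen 1%R.
Proof.
apply/esym/divg1_eq; rewrite [gen 2%R * gen 1%R]pres_mulgE -[LHS]mulg1.
rewrite -[X in _ * _ * X](mulVg (gen 0%R)).
have V : (gen 0%R)^-1 = \pi_(presented PSL2Z_rels)%qT [:: (0%R : 'I_3, true)].
  apply: (mulgI (gen 0%R)); rewrite mulgV [RHS]pres_mulgE.
  by apply/esym/pres_piP; exact: (pres_cancel _ [::] (0%R : 'I_3, false) [::]).
rewrite mulVg mulg1 V [LHS]pres_mulgE; apply: rel_eq1.
by rewrite !in_cons eqxx !orbT.
Qed.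

Lemma gen_inv : (gen 2%R)^-1 = gen 2%R /\ (gen 1%R)^-1 = gen 1%R * gen 1%R.
Proof.
split; first by apply: (mulgI (gen 2%R)); rewrite mulgV gen2_sq.
by apply: (mulgI (gen 1%R)); rewrite mulgV gen1_cube.
Qed.

(** Elements with a reduced expression in a_2 and a_1 whose leftmost letter is
a_2. *)
Inductive starts2 : PSL2Z -> Prop :=
| starts2_last e : (e < 3)%N -> starts2 (gen 2%R * gen 1%R ^+ e)
| starts2_cons e g : (0 < e < 3)%N -> starts2 g -> starts2 (gen 2%R * (gen 1%R ^+ e * g)).

(** Elements with a reduced expression; uniqueness is not needed. *)
Definition normal (g : PSL2Z) : Prop := exists2 e, (e < 3)%N &
  g = gen 1%R ^+ e \/ exists2 h, starts2 h & g = gen 1%R ^+ e * h.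

Lemma normal_gen1 g : normal g -> normal (gen 1%R * g).
Proof.
have E3 : gen 1%R * gen 1%R ^+ 2 = 1 by rewrite expgS expg1 gen1_cube.
move=> [e e3]; have [e2|e2] := ltnP e 2.
  case=> [->|[h sh ->]]; exists e.+1 => //; rewrite expgS; first by left.
  by right; exists h; rewrite ?mulgA.
have -> : e = 2%N by apply/eqP; rewrite eqn_leq e2 -ltnS e3.
case=> [->|[h sh ->]]; exists 0%N => //; first by left.
by right; exists h; rewrite // mul1g mulgA E3 mul1g.
Qed.

Lemma normal_gen2 g : normal g -> normal (gen 2%R * g).
Proof.
move=> [e e3] [->|[h sh ->]].
  by exists 0%N => //; right; exists (gen 2%R * gen 1%R ^+ e);
    [exact: starts2_last|rewrite mul1g].
case: e e3 => [|e] e3.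
  rewrite mul1g; case: h / sh => [e' e'3|e' h e'3 sh]; rewrite mulgA gen2_sq mul1g.
    by exists e' => //; left.
  by case/andP: e'3 => _ e'3; exists e' => //; right; exists h.
exists 0%N => //; right; exists (gen 2%R * (gen 1%R ^+ e.+1 * h)); last by rewrite mul1g.
by apply: starts2_cons; rewrite ?e3.
Qed.

Lemma normalP g : normal g.
Proof.
have [u ->] := presW g; elim: u => [|[i b] u IH]; first by exists 0%N => //; left.
have step x : normal (gen i * x) /\ normal ((gen i)^-1 * x) ->
    normal ((if b then (gen i)^-1 else gen i) * x) by case: b => -[].
have -> : \pi_(presented PSL2Z_rels)%qT ((i, b) :: u) =
    (if b then (gen i)^-1 else gen i) * \pi_(presented PSL2Z_rels)%qT u.
  case: b {step}; last by rewrite [RHS]pres_mulgE.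
  apply: (mulgI (gen i)); rewrite mulgA mulgV mul1g [LHS]pres_mulgE; apply/pres_piP.
  exact: (pres_cancel _ [::] (i, false) u).
move: (\pi_(presented PSL2Z_rels)%qT u) IH => x IH; apply: step.
have [V2 V1] := gen_inv; have n1 := normal_gen1; have n2 := normal_gen2.
have n11 y : normal y -> normal (gen 1%R * gen 1%R * y) by rewrite -mulgA; auto.
have [->|[->|->]] : i = 0%R \/ i = 1%R \/ i = 2%R.
  by case: (i) => [[|[|[|//]]] hi]; [left|right; left|right; right]; exact: val_inj.
- by rewrite gen0E invgM V1 V2 -!mulgA; split; auto.
- by rewrite V1 -!mulgA; split; auto.
- by rewrite V2; split; auto.
Qed.

End NormalForm.

(** * Discreteness and faithfulness near the two corners *)

Section DiscreteFaithful.
Context (R : realType) (p : @square R).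
Hypothesis hp : near_corner (\val p).
Local Notation C := R[i].
Local Notation q := (\val p).

(* The chosen lifts of the generators to U(3,1). *)
Let L (i : 'I_3) : U31 R := mkU31 (A_mx_U31 (valP p) i).

Lemma U31_valM (a b : U31 R) : \val (a * b)%g = \val a *m \val b :> 'M[C]_4.
Proof. by []. Qed.

Lemma L1E : \val (L 1%R) = A1 q :> 'M[C]_4. Proof. by []. Qed.
Lemma L2E : \val (L 2%R) = A2 R :> 'M[C]_4. Proof. by []. Qed.

Lemma rho_lift (i : 'I_3) : PU_class (L i) = rho p (gen i).
Proof. by rewrite rho_gen. Qed.

Lemma PU_class_act (a b : U31 R) : PU_class a = PU_class b ->
  exists2 c : C, c != 0 & forall z : 'cV[C]_4, \val a *m z = c *: (\val b *m z).
Proof. by move=> /PU_classP[c c0 e]; exists c => // z; rewrite e scalemxAl. Qed.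

Lemma rhoM g h : rho p (g * h)%g = (rho p g * rho p h)%g.
Proof. exact: (pres_liftM (@A_PU_rels R p)). Qed.

Lemma rho1 : rho p 1%g = 1%g.
Proof. by rewrite /rho (pres_lift_pi (@A_PU_rels R p)). Qed.

Lemma rhoV g : rho p g^-1%g = (rho p g)^-1%g.
Proof. by apply: (mulgI (rho p g)); rewrite -rhoM !mulgV rho1. Qed.

Lemma rho_pow e : PU_class (L 1%R ^+ e)%g = rho p (gen 1%R ^+ e)%g.
Proof.
elim: e => [|e IH]; last by rewrite !expgS PU_classM rhoM IH rho_lift.
by rewrite rho1.
Qed.

Lemma pow_act (e : nat) (z : 'cV[C]_4) :
  \val (L 1%R ^+ e)%g *m z = iter e (mulmx (A1 q)) z.
Proof.
elim: e => [|e IH]; first exact: mul1mx.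
by rewrite iterS -IH expgS U31_valM L1E mulmxA.
Qed.

(** The ping-pong induction on reduced expressions. *)
Lemma starts2_act g : starts2 g ->
  forall (a : U31 R) (z : 'cV[C]_4), PU_class a = rho p g ->
  fund q z -> sector q (\val a *m z).
Proof.
elim=> {g} [e e3|e g e3 sg IH] a z aE fz.
  have : PU_class a = PU_class (L 2%R * L 1%R ^+ e)%g.
    by rewrite aE PU_classM rhoM rho_lift rho_pow.
  move=> /PU_class_act[c c0 ->]; apply: sectorZ => //.
  rewrite U31_valM L2E -mulmxA pow_act; case: (fz) => J _ _ _ _.
  case: e e3 {aE} => [|[|[|//]]] _ /=; apply: sector_A2 => //; rewrite ?hnorm_A1 //.
  - exact: fund_sector.
  - exact: fund_sector_A1.
  - exact: fund_sector_A1A1.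
have [b bE] := PU_classW (rho p g).
have : PU_class a = PU_class (L 2%R * (L 1%R ^+ e * b))%g.
  by rewrite aE !PU_classM !rhoM rho_lift rho_pow bE.
move=> /PU_class_act[c c0 ->]; apply: sectorZ => //.
have := IH b z (esym bE) fz.
rewrite !U31_valM L2E -(mulmxA (A2 R)) -(mulmxA (\val (L 1%R ^+ e)%g)) pow_act.
move: (\val b *m z) => w sw.
have [J _] := sw.
case: e e3 {aE} => [|[|[|//]]] // _ /=; apply: sector_A2 => //; rewrite ?hnorm_A1 //.
- exact: sector_A1.
- exact: sector_A1A1.
Qed.

Lemma fund_disjoint g (a : U31 R) (z : 'cV[C]_4) : PU_class a = rho p g ->
  fund q z -> fund q (\val a *m z) -> g = 1%g.
Proof.
move=> aE fz; have [e e3 gE] := normalP g.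
have k0 : - cis q.1 != 0 by rewrite oppr_eq0 -nsq_eq0 nsq_cis oner_eq0.
case: gE => [gE|[h sh gE]].
  have : PU_class a = PU_class (L 1%R ^+ e)%g by rewrite aE gE rho_pow.
  move=> /PU_class_act[c c0 ->] /(fundZ (invr_neq0 c0)).
  rewrite scalerA mulVf // scale1r pow_act gE.
  case: e e3 {aE gE} => [|[|[|//]]] _ //= fw.
  - by case: (fund_A1 fz fw).
  - by case: (fund_A1A1 hp fz fw).
have [b bE] := PU_classW (rho p h).
have : PU_class a = PU_class (L 1%R ^+ e * b)%g.
  by rewrite aE gE PU_classM rhoM rho_pow bE.
move=> /PU_class_act[c c0 ->] /(fundZ (invr_neq0 c0)).
rewrite scalerA mulVf // scale1r U31_valM -mulmxA pow_act => fw.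
have sw := starts2_act sh (esym bE) fz; move: (\val b *m z) sw fw => w sw.
case: e e3 {aE gE} => [|[|[|//]]] _ //= fw.
- by case: (fund_sector fw).
- case: (fund_sector_A1A1 hp fw); rewrite A1_cube_act //; exact: sectorZ.
- case: (fund_sector_A1 hp fw); rewrite A1_cube_act //; exact: sectorZ.
Qed.

Lemma near_corner_discrete_faithful : discrete_faithful (rho p).
Proof.
have f0 := fund_base hp.
(* Right translation: the product g h^-1 would map the base point into the
   fundamental set. *)
have sep g h : forall a b : U31 R, PU_class a = rho p g -> PU_class b = rho p h ->
    fund q (\val a *m (\val b^-1%g *m base_point R)) -> g = h.
  move=> a b aE bE; rewrite mulmxA -U31_valM => fab.
  apply: divg1_eq; apply: (fund_disjoint _ f0 fab).
  rewrite PU_classM; have -> : PU_class b^-1%g = (rho p h)^-1%g.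
    apply: (mulgI (rho p h)); rewrite mulgV -bE -PU_classM mulgV.
    by [].
  by rewrite rhoM rhoV aE.
have bV (b : U31 R) : \val b *m (\val b^-1%g *m base_point R) = base_point R.
  by rewrite mulmxA -U31_valM mulgV mul1mx.
split; last first.
  move=> g h gh; have [b bE] := PU_classW (rho p h).
  by apply: (sep g h b b); rewrite ?gh // bV.
move=> _ [g _ <-]; have [b bE] := PU_classW (rho p g).
split; first by apply/mem_set; exists g.
pose O := [set a : U31 R | fund q (\val a *m (\val b^-1%g *m base_point R))].
have piO : \pi_(PU31 R)%qT @^-1` (@PU_class R @` O) = O.
  apply/seteqP; split=> a /=; last by move=> Oa; exists a.
  move=> [a' Oa' /PU_class_act[c c0 ca]].
  move: Oa'; rewrite /O /= ca => /(fundZ (invr_neq0 c0)).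
  by rewrite scalerA mulVf // scale1r.
exists (@PU_class R @` O).
  apply: open_nbhs_nbhs; split; last by exists b => //; rewrite /O /= bV.
  by rewrite /open /= /quotient_open piO; exact: open_fund.
apply/seteqP; split=> [_ [[a Oa <-] [h _ hE]]|_ ->]; last first.
  by split; [exists b => //; rewrite /O /= bV|exists g].
by rewrite -hE (sep h g a b (esym hE) (esym bE)).
Qed.

End DiscreteFaithful.

(** * The two corners *)

Section Neighbourhood.
Context (R : realType).

Lemma cos_fst_continuous (k : R) n :
  continuous (fun p : R * R => cos (p.1 / k *+ n)) /\
  continuous (fun p : R * R => sin (p.1 / k *+ n)).
Proof.
have h : continuous (fun p : R * R => p.1 / k *+ n).
  rewrite (_ : (fun p => _) = fun p => p.1 * (k^-1 *+ n)); last first.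
    by apply: funext => x; rewrite mulrnAr.
  by move=> p; apply: cvgM; [exact: cvg_fst|exact: cvg_cst].
by split=> p; apply: (continuous_comp (h p)); [exact: continuous_cos|exact: continuous_sin].
Qed.

Lemma cos_snd_continuous : continuous (fun p : R * R => cos (p.2 *+ 2)).
Proof.
have h : continuous (fun p : R * R => p.2 *+ 2).
  by move=> p; apply: cvgD; exact: cvg_snd.
by move=> p; apply: (continuous_comp (h p)); exact: continuous_cos.
Qed.

Lemma turn_continuous :
  continuous (@turn_den R) /\ continuous (@turn_num R).
Proof.
have [c1 s1] := cos_fst_continuous 3 1; have [c2 s2] := cos_fst_continuous 3 2.
have m := cos_snd_continuous.
by split=> p; [apply: cvgD (c2 p) (cvgM (m p) (c1 p))|
  apply: cvgD (s1 p) (cvgM (m p) (s2 p))].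
Qed.

(** From the triple angle formula, as cos (3 t) = 0. *)
Lemma pi6_values (t : R) : t = pi / 2 / 3 ->
  [/\ sin t = 1 / 2, 0 < cos t & cos t ^+ 2 = 3 / 4].
Proof.
move=> tE; have [ph0 ph2] := andP (pihalf_02 R).
have c0 : 0 < cos t.
  by apply: cos_gt0_pihalf; rewrite tE; apply/andP; split; lra.
have s0 : 0 < sin t.
  by apply: sin_gt0_pihalf; rewrite tE; apply/andP; split; lra.
have c3 : cos (t *+ 2 + t) = 0.
  by rewrite (_ : _ + t = pi / 2) ?cos_pihalf // tE; field.
rewrite cosD cos_mulr2n sin_mulr2n in c3.
have cs := cos2Dsin2 t.
have : cos t * (2 * cos t ^+ 2 - 1 - 2 * sin t ^+ 2) = 0 by rewrite -c3; ring.
move/eqP; rewrite mulf_eq0 gt_eqF //= => /eqP h.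
have s2 : sin t ^+ 2 = (1 / 2) ^+ 2 by lra.
split=> //; last by lra.
by apply/eqP; rewrite -(eqrXn2 (n := 2)) ?ltW // ?s2 //; lra.
Qed.

Lemma near_corner_nbhs (c : R * R) : c.1 = pi / 2 -> c.2 = 0 \/ c.2 = pi / 2 ->
  within (@square R) (nbhs c) [set p | @near_corner R p].
Proof.
move=> c1 c2.
have [sh ch cq] := pi6_values (congr1 (fun x => x / 3) c1).
set k := cos (c.1 / 3) in ch cq.
have m2 : cos (c.2 *+ 2) = 1 \/ cos (c.2 *+ 2) = -1.
  case: c2 => ->; first by left; rewrite mul0rn cos0.
  by right; rewrite (_ : _ *+ 2 = pi) ?cospi //; field.
have k9 : k < 9 / 10 by nra.
(* At both corners numerator and denominator of the translation length agree, so
   that this length is 1. *)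
have denE : turn_den c = 1 / 2 + cos (c.2 *+ 2) * k.
  by rewrite /turn_den [cos (c.1 / 3 *+ 2)]cos_mulr2n -/k cq; field.
have numE : turn_num c = turn_den c.
  by rewrite denE /turn_num sin_mulr2n sh -/k; field.
have den2 : 1 / 16 < turn_den c ^+ 2 by rewrite denE; case: m2 => ->; nra.
have [dc nc] := turn_continuous; have [cc _] := cos_fst_continuous 1 1.
have kc (x : R) : continuous (fun _ : R * R => x) by exact: cst_continuous.
have d2c : continuous (fun p : R * R => turn_den p ^+ 2).
  by move=> p; exact: cvgM (dc p) (dc p).
have d3c : continuous (fun p : R * R => 1 / 2 * turn_den p ^+ 2).
  exact: scale_continuous_fun.
have dnc : continuous (fun p : R * R => turn_num p * turn_den p).
  by move=> p; exact: cvgM (nc p) (dc p).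
have oN := openI (open_lt_fun cc (kc (1 / 2000)))
  (openI (open_lt_fun (kc (1 / 16)) d2c) (open_lt_fun d3c dnc)).
apply: filterS (open_nbhs_nbhs (conj oN _)); last first.
  split=> /=; first by rewrite divr1 mulr1n c1 cos_pihalf; lra.
  by rewrite numE -expr2; split=> //; lra.
move=> p [/= + [h2 h3]] ps; rewrite divr1 mulr1n => h1.
split; [exact/mem_set| |exact: ltW|exact: ltW|].
- case: ps => /=; rewrite in_itv /= => /andP[p0 p1] _.
  apply: sin_ge0_pi; rewrite p0 (le_trans p1) // ler_pdivrMr //.
  by have := pi_ge0 R; lra.
- have d0 : 0 < turn_den p ^+ 2 by lra.
  have dn : turn_den p != 0 by rewrite -sqrf_eq0 gt_eqF.
  rewrite -(ltr_pM2r d0); apply: lt_le_trans h3 _.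
  by rewrite /cusp_shift expr2 mulrA divfK.
Qed.

End Neighbourhood.

Theorem theorem1p3 (R : realType) :
  (exists N : set (R * R),
     [/\ N `<=` @square R,
         within (@square R) (nbhs ((pi / 2, 0) : R * R)) N &
         forall p : @square R, N (\val p) -> discrete_faithful (rho p)]) /\
  (exists N : set (R * R),
     [/\ N `<=` @square R,
         within (@square R) (nbhs ((pi / 2, pi / 2) : R * R)) N &
         forall p : @square R, N (\val p) -> discrete_faithful (rho p)]).
Proof.
have sub : [set p | near_corner p] `<=` @square R by move=> p [/set_mem].
split; exists [set p | near_corner p]; split => //.
- by apply: near_corner_nbhs => //; left.
- by move=> p; exact: near_corner_discrete_faithful.
- by apply: near_corner_nbhs => //; right.
- by move=> p; exact: near_corner_discrete_faithful.
Qed.
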